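(* Let $(u,v)$ be local coordinates on a domain of a Riemannian surface with metric $g$ such that every coordinate rectangle $[u_1,u_2]\times[v_1,v_2]$ in the domain has the Ivory property (its two geodesic diagonals, joining $(u_1,v_1)$ to $(u_2,v_2)$ and $(u_1,v_2)$ to $(u_2,v_1)$, have equal length). Then, near every point, the metric is Liouville in these coordinates: $g=(U_1(u)-V_1(v))(U_2(u)\,du^2+V_2(v)\,dv^2)$ for some functions $U_1,U_2$ of $u$ and $V_1,V_2$ of $v$.
   Context: Geodesic diagonals are the (short, locally unique) geodesic segments joining opposite corners of a small coordinate rectangle. *)

(* Defs.v *)
From Stdlib Require Import Reals Lra.
Open Scope R_scope.

Definition in_square (u0 v0 r u v : R) : Prop :=
  Rabs (u - u0) < r /\ Rabs (v - v0) < r.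

Definition is_open2 (D : R -> R -> Prop) : Prop :=
  forall u0 v0, D u0 v0 -> exists r, 0 < r /\
    forall u v, in_square u0 v0 r u v -> D u v.

Definition cont2 (D : R -> R -> Prop) (f : R -> R -> R) : Prop :=
  forall u v, D u v -> forall eps, 0 < eps -> exists delta, 0 < delta /\
    forall u' v', Rabs (u' - u) < delta -> Rabs (v' - v) < delta ->
      Rabs (f u' v' - f u v) < eps.

Definition partial_u (D : R -> R -> Prop) (f fu : R -> R -> R) : Prop :=
  forall u v, D u v -> derivable_pt_lim (fun t => f t v) u (fu u v).
Definition partial_v (D : R -> R -> Prop) (f fv : R -> R -> R) : Prop :=
  forall u v, D u v -> derivable_pt_lim (fun t => f u t) v (fv u v).

Fixpoint Ck2 (k : nat) (D : R -> R -> Prop) (f : R -> R -> R) : Prop :=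
  match k with
  | O => cont2 D f
  | S k' => cont2 D f /\ exists fu fv, partial_u D f fu /\ partial_v D f fv /\
              Ck2 k' D fu /\ Ck2 k' D fv
  end.

Definition smooth2 (D : R -> R -> Prop) (f : R -> R -> R) : Prop :=
  forall k, Ck2 k D f.

(* g = E du^2 + 2 F du dv + G dv^2 is a smooth Riemannian metric on D *)
Definition riemannian_metric (D : R -> R -> Prop) (E F G : R -> R -> R) : Prop :=
  smooth2 D E /\ smooth2 D F /\ smooth2 D G /\
  forall u v, D u v -> 0 < E u v /\ 0 < E u v * G u v - F u v ^ 2.

(* A curve t |-> (x t, y t) with velocity (dx t, dy t), defined on an open
   interval (a,b) containing [0,1], is a geodesic of g: it satisfies the
   Euler-Lagrange (geodesic) equations of the energy
   L = 1/2 (E x'^2 + 2 F x' y' + G y'^2):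
     d/dt (E x' + F y') = 1/2 (E_u x'^2 + 2 F_u x' y' + G_u y'^2)
     d/dt (F x' + G y') = 1/2 (E_v x'^2 + 2 F_v x' y' + G_v y'^2). *)
Definition is_geodesic (D : R -> R -> Prop) (E F G : R -> R -> R)
    (a b : R) (x y dx dy : R -> R) : Prop :=
  a < 0 /\ 1 < b /\
  (forall t, a < t < b ->
     D (x t) (y t) /\ derivable_pt_lim x t (dx t) /\ derivable_pt_lim y t (dy t)) /\
  exists Eu Ev Fu Fv Gu Gv : R -> R -> R,
    partial_u D E Eu /\ partial_v D E Ev /\
    partial_u D F Fu /\ partial_v D F Fv /\
    partial_u D G Gu /\ partial_v D G Gv /\
    forall t, a < t < b ->
      derivable_pt_lim
        (fun s => E (x s) (y s) * dx s + F (x s) (y s) * dy s) t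
        (/ 2 * (Eu (x t) (y t) * dx t ^ 2 + 2 * Fu (x t) (y t) * dx t * dy t
                + Gu (x t) (y t) * dy t ^ 2)) /\
      derivable_pt_lim
        (fun s => F (x s) (y s) * dx s + G (x s) (y s) * dy s) t
        (/ 2 * (Ev (x t) (y t) * dx t ^ 2 + 2 * Fv (x t) (y t) * dx t * dy t
                + Gv (x t) (y t) * dy t ^ 2)).

Definition speed (E F G : R -> R -> R) (x y dx dy : R -> R) (t : R) : R :=
  sqrt (E (x t) (y t) * dx t ^ 2 + 2 * F (x t) (y t) * dx t * dy t
        + G (x t) (y t) * dy t ^ 2).

Definition geodesic_segment_in (D : R -> R -> Prop) (E F G : R -> R -> R)
    (u0 v0 r : R) (p1 q1 p2 q2 : R) (a b : R) (x y dx dy : R -> R) : Prop :=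
  is_geodesic D E F G a b x y dx dy /\
  x 0 = p1 /\ y 0 = q1 /\ x 1 = p2 /\ y 1 = q2 /\
  forall t, 0 <= t <= 1 -> in_square u0 v0 r (x t) (y t).

Definition ivory_near (D : R -> R -> Prop) (E F G : R -> R -> R)
    (u0 v0 r : R) : Prop :=
  forall u1 u2 v1 v2, u1 < u2 -> v1 < v2 ->
  forall a1 b1 x1 y1 dx1 dy1 a2 b2 x2 y2 dx2 dy2,
    geodesic_segment_in D E F G u0 v0 r u1 v1 u2 v2 a1 b1 x1 y1 dx1 dy1 ->
    geodesic_segment_in D E F G u0 v0 r u1 v2 u2 v1 a2 b2 x2 y2 dx2 dy2 ->
    forall (pr1 : Riemann_integrable (speed E F G x1 y1 dx1 dy1) 0 1)
           (pr2 : Riemann_integrable (speed E F G x2 y2 dx2 dy2) 0 1),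
      RiemannInt pr1 = RiemannInt pr2.

Definition ivory_property (D : R -> R -> Prop) (E F G : R -> R -> R) : Prop :=
  forall u0 v0, D u0 v0 -> exists r, 0 < r /\
    (forall u v, in_square u0 v0 r u v -> D u v) /\
    ivory_near D E F G u0 v0 r.

(* Main.v *)
(** Fix a point m and compare the two diagonals of the rectangle with centre m and
    half-sides e h and e k, as e tends to 0.  The geodesic from m - e w to m + e w is
    obtained by a contraction argument; its squared length is 4 Q, where Q is the
    conserved value of g(c', c'), read off at the midpoint of the parameter interval.
    At order e^2 the odd part of Q in k is proportional to F, so F = 0.  At order e^4
    it is (2/3) (h^3 k P1 + h k^3 P2), with
      P1 = E_uv - E_u E_v / E + E_v G_u / G,
      P2 = G_uv - G_u G_v / G + E_v G_u / E.
    Hence P1 = P2 = 0.  Then (log (E / G))_uv = 0, so E / G splits as U2(u) / V2(v), and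
    lambda = E / U2 = G / V2 satisfies lambda_uv = 0, so lambda = U1(u) - V1(v). *)

Require Import Defs.
From Stdlib Require Import Reals Lra Lia List.
From Coquelicot Require Import Coquelicot.
Open Scope R_scope.
Set Bullet Behavior "Strict Subproofs".

(** * Functions of class C^k of two variables *)

(** Smooth dependence of the geodesics on e is never invoked. Each e only yields some curve solving
    the boundary value problem, so the expansions are remainder bounds, uniform over all such
    curves, and obtained by bootstrapping: an expansion of position and velocity is inserted in the
    geodesic equations, and integrating twice with the prescribed end values gains one order. The
    midpoint matters because the terms of order e in the position and e^2 in the velocity vanish
    there; a first-order Taylor expansion of E and G then reaches order e^4 in Q. The vanishing of F
    must be known at all points before that order is examined, since it also removes the derivatives
    of F from the geodesic equations. The equations are solved on [-2, 2] although the endpoints sit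
    at -1 and 1, because a geodesic segment has to extend to an open interval around its parameters.
    No logarithm is taken: the equation for log (E / G) is used as the constancy of a cross
    ratio. *)

Lemma cont2_continuity_2d_pt D f :
  cont2 D f <-> forall u v, D u v -> continuity_2d_pt f u v.
Proof.
  split.
  - intros H u v Duv eps.
    destruct (H u v Duv eps (cond_pos eps)) as [d [dpos Hd]].
    exists (mkposreal d dpos). exact Hd.
  - intros H u v Duv eps epos.
    destruct (H u v Duv (mkposreal eps epos)) as [d Hd].
    exists d. split; [apply cond_pos|exact Hd].
Qed.

Lemma Ck2_cont2 k D f : Ck2 k D f -> cont2 D f.
Proof. destruct k; simpl; tauto. Qed.

Lemma Ck2_pred k D f : Ck2 (S k) D f -> Ck2 k D f.
Proof.
  revert f. induction k as [|k IH]; intros f H.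
  - exact (proj1 H).
  - destruct H as [Hc (fu & fv & Hu & Hv & Cu & Cv)].
    split; [exact Hc|].
    exists fu, fv. repeat split; auto.
Qed.

Lemma Ck2_const k D c : Ck2 k D (fun _ _ => c).
Proof.
  revert c. induction k as [|k IH]; intros c.
  - apply cont2_continuity_2d_pt. intros. apply continuity_2d_pt_const.
  - split; [exact (Ck2_cont2 _ _ _ (IH c))|].
    exists (fun _ _ => 0), (fun _ _ => 0).
    repeat split; auto; intros u v _; apply derivable_pt_lim_const.
Qed.

Lemma Ck2_plus k D f g :
  Ck2 k D f -> Ck2 k D g -> Ck2 k D (fun u v => f u v + g u v).
Proof.
  assert (C0 : forall f g, cont2 D f -> cont2 D g ->
            cont2 D (fun u v => f u v + g u v)).
  { intros f0 g0 Hf Hg. rewrite cont2_continuity_2d_pt in Hf, Hg |- *.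
    intros; apply continuity_2d_pt_plus; auto. }
  revert f g. induction k as [|k IH]; intros f g Hf Hg; [apply C0; assumption|].
  destruct Hf as [Cf (fu & fv & Hfu & Hfv & Cfu & Cfv)].
  destruct Hg as [Cg (gu & gv & Hgu & Hgv & Cgu & Cgv)].
  split; [apply C0; assumption|].
  exists (fun u v => fu u v + gu u v), (fun u v => fv u v + gv u v).
  split; [|split; [|split; apply IH; assumption]]; intros u v Duv.
  - exact (derivable_pt_lim_plus _ _ _ _ _ (Hfu u v Duv) (Hgu u v Duv)).
  - exact (derivable_pt_lim_plus _ _ _ _ _ (Hfv u v Duv) (Hgv u v Duv)).
Qed.

Lemma Ck2_mult k D f g :
  Ck2 k D f -> Ck2 k D g -> Ck2 k D (fun u v => f u v * g u v).
Proof.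
  assert (C0 : forall f g, cont2 D f -> cont2 D g ->
            cont2 D (fun u v => f u v * g u v)).
  { intros f0 g0 Hf Hg. rewrite cont2_continuity_2d_pt in Hf, Hg |- *.
    intros; apply continuity_2d_pt_mult; auto. }
  revert f g. induction k as [|k IH]; intros f g Hf Hg; [apply C0; assumption|].
  assert (Hf' := Ck2_pred _ _ _ Hf). assert (Hg' := Ck2_pred _ _ _ Hg).
  destruct Hf as [Cf (fu & fv & Hfu & Hfv & Cfu & Cfv)].
  destruct Hg as [Cg (gu & gv & Hgu & Hgv & Cgu & Cgv)].
  split; [apply C0; assumption|].
  exists (fun u v => fu u v * g u v + f u v * gu u v),
    (fun u v => fv u v * g u v + f u v * gv u v).
  split; [|split; [|split; apply Ck2_plus; apply IH; assumption]];
    intros u v Duv.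
  - exact (derivable_pt_lim_mult _ _ _ _ _ (Hfu u v Duv) (Hgu u v Duv)).
  - exact (derivable_pt_lim_mult _ _ _ _ _ (Hfv u v Duv) (Hgv u v Duv)).
Qed.

Lemma Ck2_inv k D f : (forall u v, D u v -> f u v <> 0) ->
  Ck2 k D f -> Ck2 k D (fun u v => / f u v).
Proof.
  intros Hnz.
  assert (C0 : cont2 D f -> cont2 D (fun u v => / f u v)).
  { intros Hf. rewrite cont2_continuity_2d_pt in Hf |- *.
    intros; apply continuity_2d_pt_inv; auto. }
  induction k as [|k IH]; intros Hf; [apply C0; assumption|].
  assert (Hi := IH (Ck2_pred _ _ _ Hf)).
  destruct Hf as [Cf (fu & fv & Hfu & Hfv & Cfu & Cfv)].
  split; [apply C0; assumption|].
  (* Written with products of inverses and the constant -1, so that its regularity follows from the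
     induction hypothesis and the product lemma. *)
  exists (fun u v => (-1) * (fu u v * (/ f u v * / f u v))),
    (fun u v => (-1) * (fv u v * (/ f u v * / f u v))).
  split; [|split; [|split; apply Ck2_mult; try apply Ck2_const;
    apply Ck2_mult; auto; apply Ck2_mult; auto]]; intros u v Duv;
    apply is_derive_Reals.
  - replace (-1 * (fu u v * (/ f u v * / f u v)))
      with (- fu u v / (f u v) ^ 2) by (field; auto).
    apply (is_derive_inv (fun t => f t v)); [|auto].
    apply is_derive_Reals; auto.
  - replace (-1 * (fv u v * (/ f u v * / f u v)))
      with (- fv u v / (f u v) ^ 2) by (field; auto).
    apply (is_derive_inv (fun t => f u t)); [|auto].
    apply is_derive_Reals; auto.
Qed.

Lemma Ck2_partials k D f : Ck2 (S k) D f -> exists fu fv,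
  partial_u D f fu /\ partial_v D f fv /\ Ck2 k D fu /\ Ck2 k D fv.
Proof. intros [_ H]; exact H. Qed.

(** * Mean value estimates, Lipschitz and Taylor bounds on squares *)

Lemma mvt_bound f f' B a b :
  (forall s, Rmin a b <= s <= Rmax a b -> derivable_pt_lim f s (f' s)) ->
  (forall s, Rmin a b <= s <= Rmax a b -> Rabs (f' s) <= B) ->
  Rabs (f b - f a) <= B * Rabs (b - a).
Proof.
  intros Hd HB.
  destruct (Rtotal_order a b) as [h|[h|h]].
  - rewrite Rmin_left, Rmax_right in Hd, HB by lra.
    destruct (MVT_cor2 f f' a b h Hd) as [c [Hc Ic]].
    rewrite Hc, Rabs_mult.
    apply Rmult_le_compat_r; [apply Rabs_pos|]. apply HB; lra.
  - subst. rewrite !Rminus_diag, Rabs_R0. lra.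
  - rewrite Rmin_right, Rmax_left in Hd, HB by lra.
    destruct (MVT_cor2 f f' b a h Hd) as [c [Hc Ic]].
    rewrite Rabs_minus_sym, Hc, Rabs_mult, (Rabs_minus_sym b a).
    apply Rmult_le_compat_r; [apply Rabs_pos|]. apply HB; lra.
Qed.

Lemma Rabs_between_center c r a b s :
  Rabs (a - c) < r -> Rabs (b - c) < r ->
  Rmin a b <= s <= Rmax a b -> Rabs (s - c) < r.
Proof.
  intros Ha Hb Hs. apply Rabs_def2 in Ha. apply Rabs_def2 in Hb.
  unfold Rmin, Rmax in Hs.
  apply Rabs_def1; destruct (Rle_dec a b); lra.
Qed.

(* Splitting the displacement along the two axes reduces everything to the
   one-variable mean value theorem. *)
Lemma increment_bound_partials u0 v0 r f fu fv l m B u v u' v' :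
  partial_u (in_square u0 v0 r) f fu -> partial_v (in_square u0 v0 r) f fv ->
  (forall s, Rmin u u' <= s <= Rmax u u' -> Rabs (fu s v' - l) <= B) ->
  (forall s, Rmin v v' <= s <= Rmax v v' -> Rabs (fv u s - m) <= B) ->
  in_square u0 v0 r u v -> in_square u0 v0 r u' v' ->
  Rabs (f u' v' - f u v - l * (u' - u) - m * (v' - v))
    <= B * (Rabs (u' - u) + Rabs (v' - v)).
Proof.
  intros Hu Hv Bu Bv [S1 S2] [S3 S4].
  assert (H1 : Rabs ((f u' v' - l * u') - (f u v' - l * u)) <= B * Rabs (u' - u)).
  { apply (mvt_bound (fun s => f s v' - l * s) (fun s => fu s v' - l)).
    - intros s Is.
      apply (derivable_pt_lim_minus (fun s => f s v') (fun s => l * s)).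
      + apply Hu. split; [|assumption]. apply (Rabs_between_center u0 r u u'); assumption.
      + apply is_derive_Reals. auto_derive; [exact I|ring].
    - exact Bu. }
  assert (H2 : Rabs ((f u v' - m * v') - (f u v - m * v)) <= B * Rabs (v' - v)).
  { apply (mvt_bound (fun s => f u s - m * s) (fun s => fv u s - m)).
    - intros s Is.
      apply (derivable_pt_lim_minus (fun s => f u s) (fun s => m * s)).
      + apply Hv. split; [assumption|]. apply (Rabs_between_center v0 r v v'); assumption.
      + apply is_derive_Reals. auto_derive; [exact I|ring].
    - exact Bv. }
  replace (f u' v' - f u v - l * (u' - u) - m * (v' - v)) with
    (((f u' v' - l * u') - (f u v' - l * u)) + ((f u v' - m * v') - (f u v - m * v)))
    by ring.
  eapply Rle_trans; [apply Rabs_triang|]. lra.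
Qed.

Lemma in_square_center u v r : 0 < r -> in_square u v r u v.
Proof. intros; split; rewrite Rminus_diag, Rabs_R0; assumption. Qed.

Lemma in_square_le u0 v0 r r' u v :
  r <= r' -> in_square u0 v0 r u v -> in_square u0 v0 r' u v.
Proof. unfold in_square. intros H [? ?]; split; lra. Qed.

Lemma partial_u_sub (D D' : R -> R -> Prop) f fu :
  (forall u v, D' u v -> D u v) -> partial_u D f fu -> partial_u D' f fu.
Proof. intros H Hf u v HD; apply Hf, H, HD. Qed.

Lemma partial_v_sub (D D' : R -> R -> Prop) f fv :
  (forall u v, D' u v -> D u v) -> partial_v D f fv -> partial_v D' f fv.
Proof. intros H Hf u v HD; apply Hf, H, HD. Qed.

(** On a small square the partials stay within eps / 2 of their values at the point; the increment
    bound then leaves an error of eps / 2 times |du| + |dv|, at most eps times the larger of the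
    two. *)
Lemma differentiable_pt_lim_partials D f fu fv u v : is_open2 D ->
  partial_u D f fu -> partial_v D f fv -> cont2 D fu -> cont2 D fv ->
  D u v -> differentiable_pt_lim f u v (fu u v) (fv u v).
Proof.
  intros HD Hu Hv Cu Cv Duv eps.
  assert (e2 : 0 < eps / 2) by (pose proof (cond_pos eps); lra).
  destruct (HD u v Duv) as [r [rpos Hr]].
  destruct (Cu u v Duv _ e2) as [d1 [d1pos H1]].
  destruct (Cv u v Duv _ e2) as [d2 [d2pos H2]].
  assert (dpos : 0 < Rmin r (Rmin d1 d2)) by (repeat apply Rmin_pos; assumption).
  exists (mkposreal _ dpos). simpl. intros u' v' Iu Iv.
  assert (Rmin r (Rmin d1 d2) <= r) by apply Rmin_l.
  assert (Rmin r (Rmin d1 d2) <= d1)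
    by (eapply Rle_trans; [apply Rmin_r|apply Rmin_l]).
  assert (Rmin r (Rmin d1 d2) <= d2)
    by (eapply Rle_trans; [apply Rmin_r|apply Rmin_r]).
  assert (Z : Rabs (u - u) = 0) by (rewrite Rminus_diag; apply Rabs_R0).
  assert (Z' : Rabs (v - v) = 0) by (rewrite Rminus_diag; apply Rabs_R0).
  replace (f u' v' - f u v - (fu u v * (u' - u) + fv u v * (v' - v))) with
    (f u' v' - f u v - fu u v * (u' - u) - fv u v * (v' - v)) by ring.
  apply Rle_trans with (eps / 2 * (Rabs (u' - u) + Rabs (v' - v))).
  - apply (increment_bound_partials u v r f fu fv).
    + apply (partial_u_sub D); auto.
    + apply (partial_v_sub D); auto.
    + intros s Is. apply Rlt_le, H1; [|lra].
      apply (Rabs_between_center u d1 u u'); [rewrite Z|lra|assumption]; lra.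
    + intros s Is. apply Rlt_le, H2; [lra|].
      apply (Rabs_between_center v d2 v v'); [rewrite Z'|lra|assumption]; lra.
    + apply in_square_center; assumption.
    + split; lra.
  - pose proof (Rmax_l (Rabs (u' - u)) (Rabs (v' - v))).
    pose proof (Rmax_r (Rabs (u' - u)) (Rabs (v' - v))).
    pose proof (cond_pos eps). nra.
Qed.

(** Bounded and Lipschitz with one constant: the form in which coefficients enter both the
    contraction estimates and the first expansions. Finitely many functions can share the same K
    after shrinking the square. *)
Definition tame u0 v0 r K (f : R -> R -> R) : Prop :=
  (forall u v, in_square u0 v0 r u v -> Rabs (f u v) <= K) /\
  (forall u v u' v', in_square u0 v0 r u v -> in_square u0 v0 r u' v' ->
     Rabs (f u' v' - f u v) <= K * (Rabs (u' - u) + Rabs (v' - v))).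

Lemma tame_le u0 v0 r K r' K' f :
  r' <= r -> K <= K' -> tame u0 v0 r K f -> tame u0 v0 r' K' f.
Proof.
  intros Hr HK [Hb Hl]; split.
  - intros u v S. apply Rle_trans with K; [|assumption].
    apply Hb. eapply in_square_le; eauto.
  - intros u v u' v' S S'.
    eapply Rle_trans; [apply Hl; eapply in_square_le; eauto|].
    apply Rmult_le_compat_r; [|assumption].
    pose proof (Rabs_pos (u' - u)). pose proof (Rabs_pos (v' - v)). lra.
Qed.

Lemma cont2_locally_bounded D f u0 v0 : cont2 D f -> D u0 v0 ->
  exists r, 0 < r /\
    forall u v, in_square u0 v0 r u v -> Rabs (f u v) <= Rabs (f u0 v0) + 1.
Proof.
  intros C Hm. destruct (C u0 v0 Hm 1 Rlt_0_1) as [d [dpos Hd]].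
  exists d. split; [assumption|]. intros u v [Su Sv].
  specialize (Hd u v Su Sv).
  replace (f u v) with (f u0 v0 + (f u v - f u0 v0)) by ring.
  eapply Rle_trans; [apply Rabs_triang|]. lra.
Qed.

Lemma Ck2_tame D f u0 v0 : is_open2 D -> Ck2 1 D f -> D u0 v0 ->
  exists r K, 0 < r /\ tame u0 v0 r K f.
Proof.
  intros HD Hf Hm.
  destruct Hf as [Cf (fu & fv & Hu & Hv & Cu & Cv)].
  destruct (HD _ _ Hm) as [r0 [r0pos H0]].
  destruct (cont2_locally_bounded _ _ _ _ Cf Hm) as [r1 [r1pos H1]].
  destruct (cont2_locally_bounded _ _ _ _ Cu Hm) as [r2 [r2pos H2]].
  destruct (cont2_locally_bounded _ _ _ _ Cv Hm) as [r3 [r3pos H3]].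
  set (K := Rabs (f u0 v0) + Rabs (fu u0 v0) + Rabs (fv u0 v0) + 1).
  pose proof (Rabs_pos (f u0 v0)). pose proof (Rabs_pos (fu u0 v0)).
  pose proof (Rabs_pos (fv u0 v0)).
  set (r := Rmin (Rmin r0 r1) (Rmin r2 r3)).
  assert (r <= r0 /\ r <= r1 /\ r <= r2 /\ r <= r3).
  { unfold r. pose proof (Rmin_l (Rmin r0 r1) (Rmin r2 r3)).
    pose proof (Rmin_r (Rmin r0 r1) (Rmin r2 r3)).
    pose proof (Rmin_l r0 r1). pose proof (Rmin_r r0 r1).
    pose proof (Rmin_l r2 r3). pose proof (Rmin_r r2 r3). lra. }
  exists r, K. split; [unfold r; repeat apply Rmin_pos; assumption|]. split.
  - intros u v S. eapply Rle_trans; [apply H1|unfold K; lra].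
    apply (in_square_le _ _ r); [lra|assumption].
  - intros u v u' v' S S'.
    (* With slopes 0, the constant in the increment bound is a bound for the partials themselves. *)
    replace (f u' v' - f u v) with
      (f u' v' - f u v - 0 * (u' - u) - 0 * (v' - v)) by ring.
    apply (increment_bound_partials u0 v0 r f fu fv); try assumption.
    + apply (partial_u_sub D); [|assumption]. intros; apply H0.
      apply (in_square_le _ _ r); [lra|assumption].
    + apply (partial_v_sub D); [|assumption]. intros; apply H0.
      apply (in_square_le _ _ r); [lra|assumption].
    + intros s Is. rewrite Rminus_0_r.
      eapply Rle_trans; [apply H2|unfold K; lra].
      apply (in_square_le _ _ r); [lra|]. destruct S, S'; split; [|assumption].
      apply (Rabs_between_center u0 r u u'); assumption.
    + intros s Is. rewrite Rminus_0_r.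
      eapply Rle_trans; [apply H3|unfold K; lra].
      apply (in_square_le _ _ r); [lra|]. destruct S, S'; split; [assumption|].
      apply (Rabs_between_center v0 r v v'); assumption.
Qed.

(** The partials are Lipschitz near the point, so on the way to (u, v) they differ from [l] and [m]
    by a constant times the displacement; the mean value bound multiplies this by the displacement
    once more. *)
Lemma Ck2_taylor D f u0 v0 l m : is_open2 D -> Ck2 2 D f -> D u0 v0 ->
  derivable_pt_lim (fun t => f t v0) u0 l ->
  derivable_pt_lim (fun t => f u0 t) v0 m ->
  exists r K, 0 < r /\ forall u v, in_square u0 v0 r u v ->
    Rabs (f u v - f u0 v0 - l * (u - u0) - m * (v - v0))
      <= K * (Rabs (u - u0) + Rabs (v - v0)) ^ 2.
Proof.
  intros HD Hf Hm Hl Hk.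
  destruct Hf as [Cf (fu & fv & Hu & Hv & Cu & Cv)].
  assert (l = fu u0 v0) as -> by (eapply uniqueness_limite; [exact Hl|apply Hu, Hm]).
  assert (m = fv u0 v0) as -> by (eapply uniqueness_limite; [exact Hk|apply Hv, Hm]).
  destruct (HD _ _ Hm) as [r0 [r0pos H0]].
  destruct (Ck2_tame D fu u0 v0 HD Cu Hm) as (r1 & K1 & r1pos & [_ L1]).
  destruct (Ck2_tame D fv u0 v0 HD Cv Hm) as (r2 & K2 & r2pos & [_ L2]).
  set (r := Rmin r0 (Rmin r1 r2)).
  assert (rpos : 0 < r) by (unfold r; repeat apply Rmin_pos; assumption).
  assert (r <= r0 /\ r <= r1 /\ r <= r2).
  { unfold r. pose proof (Rmin_l r0 (Rmin r1 r2)). pose proof (Rmin_r r0 (Rmin r1 r2)).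
    pose proof (Rmin_l r1 r2). pose proof (Rmin_r r1 r2). lra. }
  assert (Hbt : forall a b s, Rmin a b <= s <= Rmax a b -> Rabs (s - a) <= Rabs (b - a)).
  { intros a b s. unfold Rmin, Rmax, Rabs.
    destruct (Rle_dec a b), (Rcase_abs (s - a)), (Rcase_abs (b - a)); lra. }
  exists r, (Rabs K1 + Rabs K2). split; [assumption|].
  intros u v S. pose proof S as [Su Sv].
  pose proof (Rabs_pos (u - u0)) as pu. pose proof (Rabs_pos (v - v0)) as pv.
  pose proof (Rle_abs K1). pose proof (Rle_abs K2).
  pose proof (Rabs_pos K1). pose proof (Rabs_pos K2).
  assert (Zu : Rabs (u0 - u0) = 0) by (rewrite Rminus_diag; apply Rabs_R0).
  assert (Zv : Rabs (v0 - v0) = 0) by (rewrite Rminus_diag; apply Rabs_R0).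
  replace ((Rabs K1 + Rabs K2) * (Rabs (u - u0) + Rabs (v - v0)) ^ 2) with
   ((Rabs K1 + Rabs K2) * (Rabs (u - u0) + Rabs (v - v0))
     * (Rabs (u - u0) + Rabs (v - v0))) by ring.
  apply (increment_bound_partials u0 v0 r f fu fv).
  - apply (partial_u_sub D); [|assumption]. intros; apply H0.
    apply (in_square_le _ _ r); [lra|assumption].
  - apply (partial_v_sub D); [|assumption]. intros; apply H0.
    apply (in_square_le _ _ r); [lra|assumption].
  - intros s Is. pose proof (Hbt _ _ _ Is).
    pose proof (Rabs_pos (s - u0)).
    eapply Rle_trans; [apply L1; split; lra|].
    nra.
  - intros s Is. pose proof (Hbt _ _ _ Is).
    pose proof (Rabs_pos (s - v0)).
    eapply Rle_trans; [apply L2; split; lra|].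
    rewrite Zu. nra.
  - apply in_square_center; assumption.
  - assumption.
Qed.

(** [Schwarz] speaks of iterated [Derive]. As [D] is open, the given partials coincide with these
    near the point, which transfers differentiability and continuity. *)
Lemma Ck2_mixed_partials D f fu fv fuv fvu u0 v0 : is_open2 D ->
  partial_u D f fu -> partial_v D f fv ->
  partial_v D fu fuv -> partial_u D fv fvu ->
  cont2 D fuv -> cont2 D fvu -> D u0 v0 -> fuv u0 v0 = fvu u0 v0.
Proof.
  intros HD Hu Hv Huv Hvu Cuv Cvu Hm.
  destruct (HD _ _ Hm) as [r [rpos Hr]].
  assert (HL : forall (P : R -> R -> Prop), (forall u v, D u v -> P u v) ->
             locally_2d P u0 v0).
  { intros P HP. exists (mkposreal r rpos). intros u v Iu Iv.
    apply HP, Hr. split; assumption. }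
  assert (Du : forall u v, D u v -> Derive (fun t => f t v) u = fu u v)
    by (intros; apply is_derive_unique, is_derive_Reals; auto).
  assert (Dv : forall u v, D u v -> Derive (fun t => f u t) v = fv u v)
    by (intros; apply is_derive_unique, is_derive_Reals; auto).
  assert (Iuv : forall u v, D u v ->
     is_derive (fun z => Derive (fun t => f t z) u) v (fuv u v)).
  { intros u v Duv. apply is_derive_ext_loc with (fun z => fu u z).
    - destruct (HD _ _ Duv) as [q [qpos Hq]]. exists (mkposreal q qpos).
      intros z Hz. symmetry. apply Du, Hq.
      split; [rewrite Rminus_diag, Rabs_R0; assumption|exact Hz].
    - apply is_derive_Reals; auto. }
  assert (Ivu : forall u v, D u v ->
     is_derive (fun z => Derive (fun t => f z t) v) u (fvu u v)).
  { intros u v Duv. apply is_derive_ext_loc with (fun z => fv z v).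
    - destruct (HD _ _ Duv) as [q [qpos Hq]]. exists (mkposreal q qpos).
      intros z Hz. symmetry. apply Dv, Hq.
      split; [exact Hz|rewrite Rminus_diag, Rabs_R0; assumption].
    - apply is_derive_Reals; auto. }
  rewrite <- (is_derive_unique _ _ _ (Iuv _ _ Hm)).
  rewrite <- (is_derive_unique _ _ _ (Ivu _ _ Hm)).
  symmetry. apply Schwarz.
  - apply HL. intros u v Duv. repeat split.
    + exists (fu u v). apply is_derive_Reals; auto.
    + exists (fv u v). apply is_derive_Reals; auto.
    + exists (fvu u v). auto.
    + exists (fuv u v). auto.
  - apply continuity_2d_pt_ext_loc with fvu.
    + apply HL. intros u v Duv. symmetry. apply is_derive_unique; auto.
    + revert Hm. apply cont2_continuity_2d_pt; assumption.
  - apply continuity_2d_pt_ext_loc with fuv.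
    + apply HL. intros u v Duv. symmetry. apply is_derive_unique; auto.
    + revert Hm. apply cont2_continuity_2d_pt; assumption.
Qed.

(** * A boundary value problem for quadratic second-order equations *)

Lemma pow_half_small B eps : 0 <= B -> 0 < eps ->
  exists N, forall n, (N <= n)%nat -> B * (/ 2) ^ n < eps.
Proof.
  intros HB He.
  destruct (pow_lt_1_zero (/ 2) ltac:(rewrite Rabs_pos_eq; lra)
              (eps / (B + 1)) ltac:(apply Rdiv_lt_0_compat; lra)) as [N HN].
  exists N. intros n Hn. specialize (HN n ltac:(lia)).
  assert (0 < (/ 2) ^ n) by (apply pow_lt; lra).
  rewrite Rabs_pos_eq in HN by lra.
  apply (Rmult_lt_compat_l (B + 1)) in HN; [|lra].
  replace ((B + 1) * (eps / (B + 1))) with eps in HN by (field; lra).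
  lra.
Qed.

(** Telescoping bounds the tail by a geometric series, whence the factor 2. The conclusion is a
    sigma type so that limits can be taken at all indices at once to form a function. *)
Lemma geometric_cauchy_limit (u : nat -> R) B :
  (forall n, Rabs (u (S n) - u n) <= B * (/ 2) ^ n) ->
  {l | forall n, Rabs (l - u n) <= 2 * B * (/ 2) ^ n}.
Proof.
  intros Hu.
  assert (HB : 0 <= B).
  { pose proof (Hu O). pose proof (Rabs_pos (u 1%nat - u 0%nat)).
    simpl in *; lra. }
  assert (Hk : forall n k, Rabs (u (k + n)%nat - u n)
                 <= 2 * B * (/ 2) ^ n * (1 - (/ 2) ^ k)).
  { intros n k. induction k as [|k IH].
    - simpl. rewrite Rminus_diag, Rabs_R0. lra.
    - replace (u (S k + n)%nat - u n) with
        ((u (S (k + n)) - u (k + n)%nat) + (u (k + n)%nat - u n))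
        by (simpl; ring).
      eapply Rle_trans; [apply Rabs_triang|].
      specialize (Hu (k + n)%nat). rewrite pow_add in Hu. simpl ((/ 2) ^ S k).
      nra. }
  assert (pos : forall n, 0 < (/ 2) ^ n) by (intros; apply pow_lt; lra).
  assert (Hb : forall n m, (n <= m)%nat -> Rabs (u m - u n) <= 2 * B * (/ 2) ^ n).
  { intros n m Hnm. replace m with ((m - n) + n)%nat by lia.
    eapply Rle_trans; [apply Hk|]. pose proof (pos n). pose proof (pos (m - n)%nat).
    assert (0 <= 2 * B * (/ 2) ^ n) by nra. nra. }
  assert (HC : Cauchy_crit u).
  { intros eps He.
    destruct (pow_half_small (2 * B) (eps / 2) ltac:(lra) ltac:(lra)) as [N HN].
    exists N. intros n m Hn Hm. unfold Rdist.
    pose proof (Hb N n ltac:(lia)) as H1. pose proof (Hb N m ltac:(lia)) as H2.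
    specialize (HN N ltac:(lia)).
    replace (u n - u m) with ((u n - u N) - (u m - u N)) by ring.
    eapply Rle_lt_trans; [apply Rabs_triang|]. rewrite Rabs_Ropp. lra. }
  destruct (Rcomplete.R_complete u HC) as [l Hl]. exists l. intros n.
  apply le_epsilon. intros eps He.
  destruct (Hl eps He) as [N HN].
  specialize (HN (max N n) ltac:(lia)). specialize (Hb n (max N n) ltac:(lia)).
  unfold Rdist in HN. rewrite Rabs_minus_sym in HN.
  replace (l - u n) with ((l - u (max N n)) + (u (max N n) - u n)) by ring.
  eapply Rle_trans; [apply Rabs_triang|]. lra.
Qed.

(** Picard iteration in the sup norm without a function space: [P] is stable under [T] and under
    uniform limits, and [T] halves distances on it. The index type is arbitrary so that a pair of
    functions on the line can be treated as a single function. *)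
Lemma uniform_contraction (I : Type) (P : (I -> R) -> Prop)
    (T : (I -> R) -> I -> R) (f0 : I -> R) B :
  P f0 -> (forall f, P f -> P (T f)) ->
  (forall (u : nat -> I -> R) f, (forall n, P (u n)) ->
     (forall eps, 0 < eps -> exists n, forall i, Rabs (f i - u n i) < eps) -> P f) ->
  (forall f g d, P f -> P g -> (forall i, Rabs (f i - g i) <= d) ->
     forall i, Rabs (T f i - T g i) <= d / 2) ->
  (forall i, Rabs (T f0 i - f0 i) <= B) -> 0 <= B ->
  exists f, P f /\ forall i, T f i = f i.
Proof.
  intros P0 PT Pcl Tc HB Bpos.
  set (u := fix u n := match n with O => f0 | S n => T (u n) end).
  assert (Pu : forall n, P (u n)) by (induction n; simpl; auto).
  assert (Hu : forall n i, Rabs (u (S n) i - u n i) <= B * (/ 2) ^ n).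
  { induction n as [|n IH]; intros i.
    - simpl. rewrite Rmult_1_r. apply HB.
    - replace (B * (/ 2) ^ S n) with (B * (/ 2) ^ n / 2) by (simpl; field).
      apply (Tc (u (S n)) (u n)); auto. }
  pose (f i := proj1_sig (geometric_cauchy_limit (fun n => u n i) B (fun n => Hu n i))).
  assert (Hf : forall i n, Rabs (f i - u n i) <= 2 * B * (/ 2) ^ n)
    by (intros i; exact (proj2_sig (geometric_cauchy_limit _ _ _))).
  clearbody f.
  assert (Hsm : forall eps, 0 < eps -> exists N, forall i n, (N <= n)%nat ->
            Rabs (f i - u n i) < eps).
  { intros eps He.
    destruct (pow_half_small (2 * B) eps ltac:(lra) He) as [N HN].
    exists N. intros i n Hn. eapply Rle_lt_trans; [apply Hf|]. auto. }
  assert (Pf : P f).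
  { apply (Pcl u); [assumption|]. intros eps He.
    destruct (Hsm eps He) as [N HN]. exists N. intros i. apply HN. lia. }
  exists f. split; [assumption|]. intros i.
  apply Rminus_diag_uniq. apply Rabs_eq_0.
  apply Rle_antisym; [|apply Rabs_pos].
  apply le_epsilon. intros eps He. rewrite Rplus_0_l.
  destruct (Hsm (eps / 2) ltac:(lra)) as [N HN].
  assert (H1 := Tc f (u N) (eps / 2) Pf (Pu N)
    (fun i => Rlt_le _ _ (HN i N ltac:(lia))) i).
  pose proof (HN i (S N) ltac:(lia)) as H2. simpl in H2.
  replace (T f i - f i) with ((T f i - T (u N) i) - (f i - T (u N) i)) by ring.
  eapply Rle_trans; [apply Rabs_triang|]. rewrite Rabs_Ropp. lra.
Qed.

(** By Rolle, z' vanishes at some c in (-1, 1). A point of [-L, L] is at distance at most 3 from c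
    and from 1, so each passage to a primitive costs a factor 3. L = 2 serves the contraction, L = 1
    the expansions. *)
Lemma boundary_value_bound L z z' f B : 1 <= L <= 2 ->
  (forall s, -L <= s <= L -> derivable_pt_lim z s (z' s)) ->
  (forall s, -L <= s <= L -> derivable_pt_lim z' s (f s)) ->
  (forall s, -L <= s <= L -> Rabs (f s) <= B) ->
  z (-1) = 0 -> z 1 = 0 ->
  forall s, -L <= s <= L -> Rabs (z' s) <= 3 * B /\ Rabs (z s) <= 9 * B.
Proof.
  intros HL Hz Hz' Hf zm zp.
  destruct (MVT_cor2 z z' (-1) 1 ltac:(lra)) as [c [Hc Ic]].
  { intros c Ic. apply Hz. lra. }
  assert (zc : z' c = 0) by lra.
  assert (Bp : 0 <= B).
  { pose proof (Hf 0 ltac:(lra)). pose proof (Rabs_pos (f 0)). lra. }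
  assert (Hin : forall a b s, -L <= a <= L -> -L <= b <= L ->
            Rmin a b <= s <= Rmax a b -> -L <= s <= L).
  { intros a b s Ha Hb. unfold Rmin, Rmax. destruct (Rle_dec a b); lra. }
  assert (H1 : forall s, -L <= s <= L -> Rabs (z' s) <= 3 * B).
  { intros s Is. rewrite <- (Rminus_0_r (z' s)), <- zc.
    apply Rle_trans with (B * Rabs (s - c)).
    - apply (mvt_bound z' f).
      + intros t It. apply Hz'. apply (Hin c s); lra.
      + intros t It. apply Hf. apply (Hin c s); lra.
    - assert (Rabs (s - c) <= 3) by (apply Rabs_le; lra). nra. }
  intros s Is. split; [auto|].
  rewrite <- (Rminus_0_r (z s)), <- zp.
  apply Rle_trans with (3 * B * Rabs (s - 1)).
  - apply (mvt_bound z z').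
    + intros t It. apply Hz. apply (Hin 1 s); lra.
    + intros t It. apply H1. apply (Hin 1 s); lra.
  - assert (Rabs (s - 1) <= 3) by (apply Rabs_le; lra). nra.
Qed.

(** * The Green operator of z'' = f with zero values at -1 and 1 *)

Definition prim (f : R -> R) (s : R) : R := RInt f 0 s.

Lemma prim_derive f s : (forall t, continuity_pt f t) ->
  derivable_pt_lim (prim f) s (f s).
Proof.
  intros Cf. apply is_derive_Reals. apply (is_derive_RInt f (prim f) 0).
  - exists (mkposreal 1 Rlt_0_1). intros t _.
    apply (RInt_correct (V := R_CompleteNormedModule)).
    apply (ex_RInt_continuous (V := R_CompleteNormedModule)). intros z _.
    apply continuity_pt_filterlim, Cf.
  - apply continuity_pt_filterlim, Cf.
Qed.

Definition dgreen (f : R -> R) (s : R) : R :=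
  prim f s - (prim (prim f) 1 - prim (prim f) (-1)) / 2.

(** The double primitive minus the affine function taking the same values at -1 and 1; [dgreen] is
    its derivative. *)
Definition green (f : R -> R) (s : R) : R :=
  prim (prim f) s - (prim (prim f) 1 + prim (prim f) (-1)) / 2
  - s * ((prim (prim f) 1 - prim (prim f) (-1)) / 2).

Lemma green_boundary f : green f (-1) = 0 /\ green f 1 = 0.
Proof. unfold green; split; field. Qed.

Lemma dgreen_derive f s : (forall t, continuity_pt f t) ->
  derivable_pt_lim (dgreen f) s (f s).
Proof.
  intros Cf. rewrite <- (Rminus_0_r (f s)).
  apply derivable_pt_lim_minus; [apply prim_derive, Cf|].
  apply derivable_pt_lim_const.
Qed.

Lemma prim_continuous f : (forall t, continuity_pt f t) ->
  forall t, continuity_pt (prim f) t.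
Proof.
  intros Cf t. apply derivable_continuous_pt.
  exists (f t). apply prim_derive, Cf.
Qed.

Lemma green_derive f s : (forall t, continuity_pt f t) ->
  derivable_pt_lim (green f) s (dgreen f s).
Proof.
  intros Cf. unfold green, dgreen.
  set (A := (prim (prim f) 1 + prim (prim f) (-1)) / 2).
  set (C := (prim (prim f) 1 - prim (prim f) (-1)) / 2).
  pose proof (prim_derive (prim f) s (prim_continuous f Cf)) as H.
  apply is_derive_Reals. apply is_derive_Reals in H.
  auto_derive; [exists (prim f s); exact H|].
  rewrite (is_derive_unique _ _ _ H : Derive (fun x : R => prim (prim f) x) s = _). ring.
Qed.

Lemma green_bound f g B : (forall t, continuity_pt f t) ->
  (forall t, continuity_pt g t) -> (forall t, Rabs (f t - g t) <= B) ->
  forall s, -2 <= s <= 2 ->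
  Rabs (dgreen f s - dgreen g s) <= 3 * B /\ Rabs (green f s - green g s) <= 9 * B.
Proof.
  intros Cf Cg HB s Is.
  destruct (green_boundary f) as [f1 f2]. destruct (green_boundary g) as [g1 g2].
  apply (boundary_value_bound 2 (fun s => green f s - green g s)
    (fun s => dgreen f s - dgreen g s) (fun s => f s - g s)); auto; try lra.
  - intros. apply (derivable_pt_lim_minus (green f) (green g));
      apply green_derive; assumption.
  - intros. apply (derivable_pt_lim_minus (dgreen f) (dgreen g));
      apply dgreen_derive; assumption.
Qed.

(** Composing with this projection keeps the iterates of the contraction bounded and continuous on
    all of R, and alters nothing on the interval where the equation is imposed. *)
Definition clamp (s : R) : R := Rmax (-2) (Rmin 2 s).

Lemma clamp_range s : -2 <= clamp s <= 2.
Proof.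
  unfold clamp, Rmax, Rmin.
  destruct (Rle_dec 2 s), (Rle_dec (-2) _); lra.
Qed.

Lemma clamp_id s : -2 <= s <= 2 -> clamp s = s.
Proof.
  intros Hs. unfold clamp, Rmax, Rmin.
  destruct (Rle_dec 2 s), (Rle_dec (-2) _); lra.
Qed.

Lemma clamp_continuous s : continuity_pt clamp s.
Proof.
  intros eps He. exists eps. split; [assumption|].
  intros t [_ Ht]. simpl in *. unfold Rdist in *.
  eapply Rle_lt_trans; [|exact Ht].
  unfold clamp, Rmax, Rmin, Rabs.
  repeat destruct Rle_dec; repeat destruct Rcase_abs; lra.
Qed.

Lemma continuity_pt_tame u0 v0 r K f x y s : tame u0 v0 r K f ->
  (forall t, in_square u0 v0 r (x t) (y t)) ->
  continuity_pt x s -> continuity_pt y s ->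
  continuity_pt (fun t => f (x t) (y t)) s.
Proof.
  intros [_ Hl] Hs Cx Cy eps He.
  set (q := eps / (2 * (Rabs K + 1))).
  assert (HK : 0 < q).
  { apply Rdiv_lt_0_compat; [assumption|]. pose proof (Rabs_pos K). lra. }
  destruct (Cx _ HK) as [d1 [d1p H1]]. destruct (Cy _ HK) as [d2 [d2p H2]].
  exists (Rmin d1 d2). split; [apply Rmin_pos; assumption|].
  intros t [Dt Ht]. simpl in *. unfold Rdist in *.
  pose proof (Rmin_l d1 d2). pose proof (Rmin_r d1 d2).
  assert (Hx := H1 t (conj Dt (Rlt_le_trans _ _ _ Ht H))).
  assert (Hy := H2 t (conj Dt (Rlt_le_trans _ _ _ Ht H0))).
  clear H1 H2.
  eapply Rle_lt_trans; [apply Hl; auto|].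
  pose proof (Rle_abs K). pose proof (Rabs_pos K).
  pose proof (Rabs_pos (x t - x s)). pose proof (Rabs_pos (y t - y s)).
  apply Rle_lt_trans with ((Rabs K + 1) * (Rabs (x t - x s) + Rabs (y t - y s))).
  { apply Rmult_le_compat_r; lra. }
  replace eps with ((Rabs K + 1) * (q + q)) by (unfold q; field; lra).
  apply Rmult_lt_compat_l; lra.
Qed.

(** * Quadratic forms in the velocity with coefficients depending on the position *)

Definition quad (a b c : R -> R -> R) (x y p q : R) : R :=
  a x y * p * p + b x y * p * q + c x y * q * q.

Lemma term_bound A p q K e : Rabs A <= K -> Rabs p <= 2 * e -> Rabs q <= 2 * e ->
  Rabs (A * p * q) <= K * 4 * e ^ 2.
Proof.
  intros HA Hp Hq. rewrite !Rabs_mult.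
  pose proof (Rabs_pos A). pose proof (Rabs_pos p). pose proof (Rabs_pos q).
  replace (K * 4 * e ^ 2) with (K * (2 * e) * (2 * e)) by ring.
  apply Rmult_le_compat; try assumption; [apply Rmult_le_pos; assumption|].
  apply Rmult_le_compat; assumption.
Qed.

(** One factor is changed at a time: the coefficient contributes 18 K d (2 e)^2 <= 72 K e d since e
    <= 1, and each velocity 6 K e d. The 18 is twice the position factor 9 of
    [boundary_value_bound], the 3 its velocity factor. *)
Lemma term_diff A A' p p' q q' K e d : 0 < e <= 1 -> Rabs A <= K -> 
  Rabs p <= 2 * e -> Rabs p' <= 2 * e -> Rabs q <= 2 * e -> Rabs q' <= 2 * e ->
  Rabs (A' - A) <= K * 18 * d -> Rabs (p' - p) <= 3 * d -> Rabs (q' - q) <= 3 * d ->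
  Rabs (A' * p' * q' - A * p * q) <= K * 84 * e * d.
Proof.
  intros He HA Hp Hp' Hq Hq' DA Dp Dq.
  assert (Kp : 0 <= K) by (pose proof (Rabs_pos A); lra).
  assert (dp : 0 <= d) by (pose proof (Rabs_pos (p' - p)); lra).
  replace (A' * p' * q' - A * p * q) with
    ((A' - A) * p' * q' + (A * (p' - p) * q' + A * p * (q' - q))) by ring.
  eapply Rle_trans; [apply Rabs_triang|].
  assert (H1 : Rabs ((A' - A) * p' * q') <= K * 18 * d * 4 * e ^ 2)
    by (apply term_bound; assumption).
  assert (HM : forall a b c A B C, Rabs a <= A -> Rabs b <= B -> Rabs c <= C ->
            Rabs (a * b * c) <= A * B * C).
  { intros a b c A0 B0 C0 Ha Hb Hc. rewrite !Rabs_mult.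
    apply Rmult_le_compat; try assumption; try apply Rabs_pos;
      [apply Rmult_le_pos; apply Rabs_pos|].
    apply Rmult_le_compat; try assumption; apply Rabs_pos. }
  assert (H2 : Rabs (A * (p' - p) * q') <= K * (3 * d) * (2 * e)) by (apply HM; assumption).
  assert (H3 : Rabs (A * p * (q' - q)) <= K * (2 * e) * (3 * d)) by (apply HM; assumption).
  pose proof (Rabs_triang (A * (p' - p) * q') (A * p * (q' - q))).
  assert (K * 18 * d * 4 * e ^ 2 <= K * 72 * e * d).
  { replace (K * 18 * d * 4 * e ^ 2) with ((K * d * e * 72) * e) by ring.
    replace (K * 72 * e * d) with ((K * d * e * 72) * 1) by ring.
    apply Rmult_le_compat_l; [|lra].
    repeat apply Rmult_le_pos; lra. }
  lra.
Qed.

Lemma quad_bound u0 v0 r K e a b c x y p q :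
  tame u0 v0 r K a -> tame u0 v0 r K b -> tame u0 v0 r K c ->
  in_square u0 v0 r x y -> Rabs p <= 2 * e -> Rabs q <= 2 * e ->
  Rabs (quad a b c x y p q) <= 12 * K * e ^ 2.
Proof.
  intros [Ba _] [Bb _] [Bc _] S Hp Hq. unfold quad.
  eapply Rle_trans; [apply Rabs_triang|].
  pose proof (Rabs_triang (a x y * p * p) (b x y * p * q)).
  pose proof (term_bound _ p p _ e (Ba _ _ S) Hp Hp).
  pose proof (term_bound _ p q _ e (Bb _ _ S) Hp Hq).
  pose proof (term_bound _ q q _ e (Bc _ _ S) Hq Hq). lra.
Qed.

Lemma quad_diff u0 v0 r K e d a b c x y p q x' y' p' q' : 0 < e <= 1 ->
  tame u0 v0 r K a -> tame u0 v0 r K b -> tame u0 v0 r K c ->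
  in_square u0 v0 r x y -> in_square u0 v0 r x' y' ->
  Rabs p <= 2 * e -> Rabs q <= 2 * e -> Rabs p' <= 2 * e -> Rabs q' <= 2 * e ->
  Rabs (x' - x) <= 9 * d -> Rabs (y' - y) <= 9 * d ->
  Rabs (p' - p) <= 3 * d -> Rabs (q' - q) <= 3 * d ->
  Rabs (quad a b c x' y' p' q' - quad a b c x y p q) <= K * 252 * e * d.
Proof.
  intros He [Ba La] [Bb Lb] [Bc Lc] S S' Hp Hq Hp' Hq' Dx Dy Dp Dq. unfold quad.
  assert (Kp : 0 <= K).
  { pose proof (Ba _ _ S). pose proof (Rabs_pos (a x y)). lra. }
  assert (HL : forall X, X <= K * (Rabs (x' - x) + Rabs (y' - y)) -> X <= K * 18 * d).
  { intros X HX. eapply Rle_trans; [exact HX|].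
    rewrite Rmult_assoc. apply Rmult_le_compat_l; lra. }
  replace (_ - _) with ((a x' y' * p' * p' - a x y * p * p) +
    ((b x' y' * p' * q' - b x y * p * q) + (c x' y' * q' * q' - c x y * q * q))) by ring.
  eapply Rle_trans; [apply Rabs_triang|].
  pose proof (Rabs_triang (b x' y' * p' * q' - b x y * p * q)
                (c x' y' * q' * q' - c x y * q * q)).
  pose proof (term_diff (a x y) (a x' y') p p' p p' K e d He (Ba _ _ S) Hp Hp' Hp Hp'
     (HL _ (La _ _ _ _ S S')) Dp Dp).
  pose proof (term_diff (b x y) (b x' y') p p' q q' K e d He (Bb _ _ S) Hp Hp' Hq Hq'
     (HL _ (Lb _ _ _ _ S S')) Dp Dq).
  pose proof (term_diff (c x y) (c x' y') q q' q q' K e d He (Bc _ _ S) Hq Hq' Hq Hq'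
     (HL _ (Lc _ _ _ _ S S')) Dq Dq).
  lra.
Qed.

(** Velocities and accelerations are stored as data; [bvp_solution] ties them to the positions
    through [derivable_pt_lim]. *)
Record curve := Curve {
  cx : R -> R; cy : R -> R;
  vx : R -> R; vy : R -> R;
  ax : R -> R; ay : R -> R }.

(** The endpoints are reached at -1 and 1, but the equations hold on [-2, 2], which later provides
    the open interval around the segment. The a priori bound [M * e ^ 2] on the accelerations is
    recorded because it starts the asymptotic expansion. *)
Definition bvp_solution (u0 v0 r : R) (a1 b1 c1 a2 b2 c2 : R -> R -> R)
    (M h k e : R) (c : curve) : Prop :=
  (cx c (-1) = u0 - e * h /\ cx c 1 = u0 + e * h /\
   cy c (-1) = v0 - e * k /\ cy c 1 = v0 + e * k) /\
  forall s, -2 <= s <= 2 ->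
    in_square u0 v0 r (cx c s) (cy c s) /\
    (derivable_pt_lim (cx c) s (vx c s) /\ derivable_pt_lim (cy c) s (vy c s)) /\
    (derivable_pt_lim (vx c) s (ax c s) /\ derivable_pt_lim (vy c) s (ay c s)) /\
    (ax c s = quad a1 b1 c1 (cx c s) (cy c s) (vx c s) (vy c s) /\
     ay c s = quad a2 b2 c2 (cx c s) (cy c s) (vx c s) (vy c s)) /\
    (Rabs (ax c s) <= M * e ^ 2 /\ Rabs (ay c s) <= M * e ^ 2).

Lemma quad_continuous u0 v0 r K a b c x y p q s :
  tame u0 v0 r K a -> tame u0 v0 r K b -> tame u0 v0 r K c ->
  (forall t, in_square u0 v0 r (x t) (y t)) ->
  continuity_pt x s -> continuity_pt y s -> continuity_pt p s -> continuity_pt q s ->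
  continuity_pt (fun t => quad a b c (x t) (y t) (p t) (q t)) s.
Proof.
  intros Ta Tb Tc S Cx Cy Cp Cq. unfold quad.
  repeat apply (continuity_pt_plus (fun t => _) (fun t => _));
  apply (continuity_pt_mult (fun t => _ * _) (fun t => _)); try assumption;
  apply (continuity_pt_mult (fun t => _ (x t) (y t)) (fun t => _)); try assumption;
  eapply continuity_pt_tame; eassumption.
Qed.

Lemma continuity_pt_uniform_limit (u : nat -> R -> R) f s :
  (forall n, continuity_pt (u n) s) ->
  (forall eps, 0 < eps -> exists n, forall t, Rabs (f t - u n t) < eps) ->
  continuity_pt f s.
Proof.
  intros Cu Hu eps He.
  destruct (Hu (eps / 3) ltac:(lra)) as [n Hn].
  destruct (Cu n (eps / 3) ltac:(lra)) as [d [dp Hd]].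
  exists d. split; [assumption|]. intros t Ht. specialize (Hd t Ht).
  simpl in *. unfold Rdist in *.
  replace (f t - f s) with ((f t - u n t) + ((u n t - u n s) - (f s - u n s))) by ring.
  eapply Rle_lt_trans; [apply Rabs_triang|].
  pose proof (Rabs_triang (u n t - u n s) (- (f s - u n s))) as H.
  rewrite Rabs_Ropp in H. pose proof (Hn t). pose proof (Hn s).
  unfold Rminus in *. lra.
Qed.

(* Contraction on the accelerations; the ODE is imposed on [-2, 2], beyond the
   prescribed endpoints at parameters -1 and 1, and [clamp] extends it to R. *)
Lemma bvp_exists u0 v0 r K a1 b1 c1 a2 b2 c2 : 0 < r -> 1 <= K ->
  tame u0 v0 r K a1 -> tame u0 v0 r K b1 -> tame u0 v0 r K c1 ->
  tame u0 v0 r K a2 -> tame u0 v0 r K b2 -> tame u0 v0 r K c2 ->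
  exists e0, 0 < e0 <= 1 /\ forall e h k, 0 < e < e0 -> Rabs h <= 1 -> Rabs k <= 1 ->
    exists c, bvp_solution u0 v0 r a1 b1 c1 a2 b2 c2 (12 * K) h k e c.
Proof.
  intros rpos K1 Ta1 Tb1 Tc1 Ta2 Tb2 Tc2.
  assert (K0 : 0 < / (600 * K)) by (apply Rinv_0_lt_compat; lra).
  assert (K2 : / (600 * K) <= 1).
  { rewrite <- Rinv_1. apply Rinv_le_contravar; lra. }
  (* The constant 600 covers two needs: 252 K e <= 1 / 2 makes the map a contraction, and 432 K e <=
     1 gives 36 B <= e for B = 12 K e^2. With r / 6, positions stay within 2 e + e / 4 < r of the
     centre. *)
  exists (Rmin (/ (600 * K)) (r / 6)). split.
  { pose proof (Rmin_l (/ (600 * K)) (r / 6)).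
    split; [apply Rmin_pos; lra|lra]. }
  intros e h k [e0 He] Hh Hk.
  pose proof (Rmin_l (/ (600 * K)) (r / 6)). pose proof (Rmin_r (/ (600 * K)) (r / 6)).
  assert (He1 : 600 * K * e <= 1).
  { apply Rmult_le_reg_l with (/ (600 * K)); [assumption|].
    rewrite <- Rmult_assoc, Rinv_l by lra. lra. }
  assert (e1 : e <= 1) by lra.
  set (B := 12 * K * e ^ 2).
  assert (B0 : 0 <= B) by (unfold B; nra).
  assert (B1 : 36 * B <= e) by (unfold B; simpl; nra).
  (* The unknown is the pair of accelerations, coded as one function on two copies of the line:
     [true] for the first coordinate, [false] for the second. Positions and velocities are recovered
     by adding the Green operator to the straight motion. *)
  pose (P := fun f : bool * R -> R =>
     (forall b t, continuity_pt (fun t => f (b, t)) t) /\ forall i, Rabs (f i) <= B).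
  pose (X := fun (f : bool * R -> R) s => u0 + s * (e * h) + green (fun t => f (true, t)) s).
  pose (Y := fun (f : bool * R -> R) s => v0 + s * (e * k) + green (fun t => f (false, t)) s).
  pose (VX := fun (f : bool * R -> R) s => e * h + dgreen (fun t => f (true, t)) s).
  pose (VY := fun (f : bool * R -> R) s => e * k + dgreen (fun t => f (false, t)) s).
  pose (T := fun (f : bool * R -> R) (i : bool * R) => let (b, t) := i in
     let s := clamp t in
     if b then quad a1 b1 c1 (X f s) (Y f s) (VX f s) (VY f s)
     else quad a2 b2 c2 (X f s) (Y f s) (VX f s) (VY f s)).
  assert (G0 : forall f b s, P f -> -2 <= s <= 2 ->
    Rabs (dgreen (fun t => f (b, t)) s) <= 3 * B /\
    Rabs (green (fun t => f (b, t)) s) <= 9 * B).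
  { intros f b s [Pc Pb] Is. destruct (green_boundary (fun t => f (b, t))).
    apply (boundary_value_bound 2 _ _ (fun t => f (b, t))); auto; try lra.
    - intros; apply green_derive, Pc.
    - intros; apply dgreen_derive, Pc. }
  assert (Ae : forall l, Rabs l <= 1 -> Rabs (e * l) <= e).
  { intros l Hl. rewrite Rabs_mult, (Rabs_pos_eq e) by lra. nra. }
  assert (As : forall s l, -2 <= s <= 2 -> Rabs l <= 1 -> Rabs (s * (e * l)) <= 2 * e).
  { intros s l Is Hl. rewrite Rabs_mult.
    assert (Rabs s <= 2) by (apply Rabs_le; lra).
    apply Rmult_le_compat; auto using Rabs_pos. }
  assert (GS : forall f s, P f -> -2 <= s <= 2 -> in_square u0 v0 r (X f s) (Y f s)).
  { intros f s Pf Is. unfold X, Y. split.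
    - replace (_ - _) with (s * (e * h) + green (fun t => f (true, t)) s) by ring.
      eapply Rle_lt_trans; [apply Rabs_triang|].
      pose proof (G0 f true s Pf Is). pose proof (As s h Is Hh). lra.
    - replace (_ - _) with (s * (e * k) + green (fun t => f (false, t)) s) by ring.
      eapply Rle_lt_trans; [apply Rabs_triang|].
      pose proof (G0 f false s Pf Is). pose proof (As s k Is Hk). lra. }
  assert (GV : forall f s, P f -> -2 <= s <= 2 ->
     Rabs (VX f s) <= 2 * e /\ Rabs (VY f s) <= 2 * e).
  { intros f s Pf Is. unfold VX, VY. split;
      (eapply Rle_trans; [apply Rabs_triang|]).
    - pose proof (G0 f true s Pf Is). pose proof (Ae h Hh). lra.
    - pose proof (G0 f false s Pf Is). pose proof (Ae k Hk). lra. }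
  assert (DX : forall f s, P f -> derivable_pt_lim (X f) s (VX f s)).
  { intros f s [Pc _]. unfold X, VX.
    apply (derivable_pt_lim_plus (fun s => u0 + s * (e * h)) (green _));
      [|apply green_derive, Pc].
    apply is_derive_Reals. auto_derive; [exact I|ring]. }
  assert (DY : forall f s, P f -> derivable_pt_lim (Y f) s (VY f s)).
  { intros f s [Pc _]. unfold Y, VY.
    apply (derivable_pt_lim_plus (fun s => v0 + s * (e * k)) (green _));
      [|apply green_derive, Pc].
    apply is_derive_Reals. auto_derive; [exact I|ring]. }
  assert (DVX : forall f s, P f -> derivable_pt_lim (VX f) s (f (true, s))).
  { intros f s [Pc _]. unfold VX. rewrite <- (Rplus_0_l (f (true, s))).
    apply (derivable_pt_lim_plus (fun s => e * h) (dgreen _));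
      [apply derivable_pt_lim_const|].
    apply (dgreen_derive (fun t => f (true, t))), Pc. }
  assert (DVY : forall f s, P f -> derivable_pt_lim (VY f) s (f (false, s))).
  { intros f s [Pc _]. unfold VY. rewrite <- (Rplus_0_l (f (false, s))).
    apply (derivable_pt_lim_plus (fun s => e * k) (dgreen _));
      [apply derivable_pt_lim_const|].
    apply (dgreen_derive (fun t => f (false, t))), Pc. }
  assert (Hcl : forall F F' s, (forall s, derivable_pt_lim F s (F' s)) ->
     continuity_pt (fun t => F (clamp t)) s).
  { intros F F' s HF. apply (continuity_pt_comp clamp F); [apply clamp_continuous|].
    apply derivable_continuous_pt. exists (F' (clamp s)). apply HF. }
  destruct (uniform_contraction _ P T (fun _ => 0) B) as [f [Pf Tf]].
  - split.
    + intros _ t. apply continuity_pt_const. intros ? ?; reflexivity.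
    + intros _. rewrite Rabs_R0. assumption.
  - intros f Pf. split.
    + intros b t.
      assert (CX := Hcl (X f) (VX f) t (fun s => DX f s Pf)).
      assert (CY := Hcl (Y f) (VY f) t (fun s => DY f s Pf)).
      assert (CVX := Hcl (VX f) _ t (fun s => DVX f s Pf)).
      assert (CVY := Hcl (VY f) _ t (fun s => DVY f s Pf)).
      assert (S : forall t, in_square u0 v0 r (X f (clamp t)) (Y f (clamp t)))
        by (intros; apply GS; [assumption|apply clamp_range]).
      destruct b; unfold T.
      * exact (quad_continuous _ _ _ _ _ _ _ _ _ _ _ _ Ta1 Tb1 Tc1 S CX CY CVX CVY).
      * exact (quad_continuous _ _ _ _ _ _ _ _ _ _ _ _ Ta2 Tb2 Tc2 S CX CY CVX CVY).
    + intros [b t]. pose proof (clamp_range t) as Hc.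
      destruct (GV f _ Pf Hc). unfold T, B.
      destruct b; eapply quad_bound; eauto.
  - intros u f Pu Hu. split.
    + intros b t. apply (continuity_pt_uniform_limit (fun n t => u n (b, t))).
      * intros n. apply Pu.
      * intros eps Heps. destruct (Hu eps Heps) as [n Hn]. exists n. auto.
    + intros i. apply le_epsilon. intros eps Heps.
      destruct (Hu eps Heps) as [n Hn]. pose proof (proj2 (Pu n) i).
      replace (f i) with (u n i + (f i - u n i)) by ring.
      eapply Rle_trans; [apply Rabs_triang|]. specialize (Hn i). lra.
  - intros f g d Pf Pg Hd [b t].
    pose proof (clamp_range t) as Hc.
    assert (d0 : 0 <= d).
    { specialize (Hd (b, t)). pose proof (Rabs_pos (f (b, t) - g (b, t))). lra. }
    assert (Dg : forall b, Rabs (dgreen (fun t => f (b, t)) (clamp t)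
        - dgreen (fun t => g (b, t)) (clamp t)) <= 3 * d /\
       Rabs (green (fun t => f (b, t)) (clamp t)
        - green (fun t => g (b, t)) (clamp t)) <= 9 * d).
    { intros b'. apply green_bound; auto; [apply Pf|apply Pg]. }
    destruct (Dg true) as [D1 D2]. destruct (Dg false) as [D3 D4].
    destruct (GV f _ Pf Hc). destruct (GV g _ Pg Hc).
    assert (EX : Rabs (X f (clamp t) - X g (clamp t)) <= 9 * d)
      by (unfold X; replace (_ - _) with (green (fun t => f (true, t)) (clamp t)
        - green (fun t => g (true, t)) (clamp t)) by ring; assumption).
    assert (EY : Rabs (Y f (clamp t) - Y g (clamp t)) <= 9 * d)
      by (unfold Y; replace (_ - _) with (green (fun t => f (false, t)) (clamp t)
        - green (fun t => g (false, t)) (clamp t)) by ring; assumption).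
    assert (EVX : Rabs (VX f (clamp t) - VX g (clamp t)) <= 3 * d)
      by (unfold VX; replace (_ - _) with (dgreen (fun t => f (true, t)) (clamp t)
        - dgreen (fun t => g (true, t)) (clamp t)) by ring; assumption).
    assert (EVY : Rabs (VY f (clamp t) - VY g (clamp t)) <= 3 * d)
      by (unfold VY; replace (_ - _) with (dgreen (fun t => f (false, t)) (clamp t)
        - dgreen (fun t => g (false, t)) (clamp t)) by ring; assumption).
    assert (Kd : K * 252 * e * d <= d / 2) by nra.
    eapply Rle_trans; [|exact Kd].
    unfold T; destruct b; eapply quad_diff; eauto.
  - intros [b t]. rewrite Rminus_0_r.
    assert (P0 : P (fun _ => 0)).
    { split.
      + intros _ t0. apply continuity_pt_const. intros ? ?; reflexivity.
      + intros _. rewrite Rabs_R0. assumption. }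
    pose proof (clamp_range t) as Hc. destruct (GV _ _ P0 Hc).
    unfold T, B; destruct b; eapply quad_bound; eauto.
  - assumption.
  - exists (Curve (X f) (Y f) (VX f) (VY f) (fun t => f (true, t)) (fun t => f (false, t))).
    split; simpl.
    + destruct (green_boundary (fun t => f (true, t))) as [g1 g2].
      destruct (green_boundary (fun t => f (false, t))) as [g3 g4].
      unfold X, Y. rewrite g1, g2, g3, g4. repeat split; ring.
    + intros s Is. split; [auto|]. split; [auto|]. split; [split; auto|].
      split; [|split; apply Pf].
      rewrite <- (Tf (true, s)), <- (Tf (false, s)). unfold T.
      rewrite clamp_id by assumption. split; reflexivity.
Qed.

(** * Asymptotic expansion of short solutions *)

(** One constant serves all indices satisfying [P], and no limit is taken: [e] is itself a function
    of the index, so uniformity in time and in the curve is built in. *)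
Definition bigO {A : Type} (P : A -> Prop) (e : A -> R) (n : nat) (f : A -> R) : Prop :=
  exists C, forall a, P a -> Rabs (f a) <= C * e a ^ n.

Definition scale {A : Type} (P : A -> Prop) (e : A -> R) : Prop :=
  forall a, P a -> 0 < e a <= 1.

Lemma bigO_ext {A} (P : A -> Prop) e n f g :
  (forall a, P a -> f a = g a) -> bigO P e n f -> bigO P e n g.
Proof. intros H [C HC]. exists C. intros a Pa. rewrite <- H; auto. Qed.

Lemma bigO_plus {A} (P : A -> Prop) e n f g :
  bigO P e n f -> bigO P e n g -> bigO P e n (fun a => f a + g a).
Proof.
  intros [C HC] [C' HC']. exists (C + C'). intros a Pa.
  eapply Rle_trans; [apply Rabs_triang|].
  specialize (HC a Pa). specialize (HC' a Pa). lra.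
Qed.

Lemma bigO_opp {A} (P : A -> Prop) e n f :
  bigO P e n f -> bigO P e n (fun a => - f a).
Proof. intros [C HC]. exists C. intros a Pa. rewrite Rabs_Ropp; auto. Qed.

Lemma bigO_minus {A} (P : A -> Prop) e n f g :
  bigO P e n f -> bigO P e n g -> bigO P e n (fun a => f a - g a).
Proof. intros Hf Hg. apply bigO_plus; [assumption|]. apply bigO_opp; assumption. Qed.

Lemma bigO_mult {A} (P : A -> Prop) e n m f g :
  bigO P e n f -> bigO P e m g -> bigO P e (n + m) (fun a => f a * g a).
Proof.
  intros [C HC] [C' HC']. exists (C * C'). intros a Pa.
  rewrite Rabs_mult, pow_add.
  replace (C * C' * (e a ^ n * e a ^ m)) with ((C * e a ^ n) * (C' * e a ^ m)) by ring.
  apply Rmult_le_compat; auto using Rabs_pos.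
Qed.

Lemma bigO_le {A} (P : A -> Prop) e n m f : scale P e -> (m <= n)%nat ->
  bigO P e n f -> bigO P e m f.
Proof.
  intros He Hmn [C HC]. exists (Rabs C). intros a Pa.
  eapply Rle_trans; [apply HC; assumption|]. destruct (He a Pa) as [e0 e1].
  apply Rle_trans with (Rabs C * e a ^ n).
  - apply Rmult_le_compat_r; [apply pow_le; lra|apply Rle_abs].
  - apply Rmult_le_compat_l; [apply Rabs_pos|].
    replace n with ((n - m) + m)%nat by lia. rewrite pow_add.
    rewrite <- (Rmult_1_l (e a ^ m)) at 2.
    apply Rmult_le_compat_r; [apply pow_le; lra|].
    rewrite <- (pow1 (n - m)). apply pow_incr; lra.
Qed.

Lemma bigO_const {A} (P : A -> Prop) e c : bigO P e 0 (fun _ => c).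
Proof. exists (Rabs c). intros; simpl; lra. Qed.

Lemma bigO_pow {A} (P : A -> Prop) e n : scale P e -> bigO P e n (fun a => e a ^ n).
Proof.
  intros He. exists 1. intros a Pa. destruct (He a Pa).
  rewrite Rabs_pos_eq; [lra|apply pow_le; lra].
Qed.

Lemma bigO_pow_mult {A} (P : A -> Prop) e n f : scale P e ->
  bigO P e 0 f -> bigO P e n (fun a => e a ^ n * f a).
Proof.
  intros He Hf. replace n with (n + 0)%nat at 1 by lia.
  apply bigO_mult; [apply bigO_pow, He|assumption].
Qed.

Definition approx {A : Type} (P : A -> Prop) (e : A -> R) n (f g : A -> R) : Prop :=
  bigO P e n (fun a => f a - g a).

Lemma approx_trans {A} (P : A -> Prop) e n f g h :
  approx P e n f g -> approx P e n g h -> approx P e n f h.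
Proof.
  intros H1 H2. apply bigO_ext with (fun a => (f a - g a) + (g a - h a)).
  - intros; ring.
  - apply bigO_plus; assumption.
Qed.

Lemma approx_plus {A} (P : A -> Prop) e n f g f' g' :
  approx P e n f g -> approx P e n f' g' ->
  approx P e n (fun a => f a + f' a) (fun a => g a + g' a).
Proof.
  intros H1 H2. apply bigO_ext with (fun a => (f a - g a) + (f' a - g' a)).
  - intros; ring.
  - apply bigO_plus; assumption.
Qed.

(** f f' - g g' = (f - g) f' + g (f' - g'). The orders are tracked separately because velocities are
    small: an error on one factor is improved by the size of the other. *)
Lemma approx_mult {A} (P : A -> Prop) e n i j k l f g f' g' : scale P e ->
  approx P e i f g -> bigO P e j f' -> bigO P e k g -> approx P e l f' g' ->
  (n <= i + j)%nat -> (n <= k + l)%nat ->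
  approx P e n (fun a => f a * f' a) (fun a => g a * g' a).
Proof.
  intros He H1 Hf Hg H2 L1 L2.
  apply bigO_ext with (fun a => (f a - g a) * f' a + g a * (f' a - g' a)).
  - intros; ring.
  - apply bigO_plus.
    + apply (bigO_le _ _ (i + j)); auto. apply bigO_mult; assumption.
    + apply (bigO_le _ _ (k + l)); auto. apply bigO_mult; assumption.
Qed.

Lemma approx_bigO {A} (P : A -> Prop) e n m f g : scale P e -> (m <= n)%nat ->
  approx P e n f g -> bigO P e m g -> bigO P e m f.
Proof.
  intros He L H Hg. apply bigO_ext with (fun a => (f a - g a) + g a).
  - intros; ring.
  - apply bigO_plus; [|assumption]. apply (bigO_le _ _ n); assumption.
Qed.

Ltac bounded :=
  repeat (first [assumption
    | apply bigO_const
    | apply bigO_plus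
    | apply bigO_minus
    | apply (bigO_mult _ _ 0 0)
    | apply bigO_opp ]).

(** The result is the product linearized in a small quantity [t] whose square is negligible at order
    [n]. Each velocity carries a factor e, which raises the order of the error from n to n + 1 for
    it and to n + 2 for the product. The uses are t = 0, t = e times the time, and t = e^2. *)
Lemma term_approx {A} (P : A -> Prop) e n m t a p q A0 A1 h k X Y : scale P e ->
  bigO P e m t -> (n <= m + m)%nat ->
  approx P e n a (fun i => A0 + t i * A1) ->
  approx P e (S n) p (fun i => e i * (h + t i * X)) ->
  approx P e (S n) q (fun i => e i * (k + t i * Y)) ->
  approx P e (S (S n)) (fun i => a i * p i * q i)
    (fun i => e i ^ 2 * (A0 * h * k + t i * (A1 * h * k + A0 * (h * Y + k * X)))).
Proof.
  intros He Ht Hn Ha Hp Hq.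
  assert (Bt : bigO P e 0 t) by (apply (bigO_le _ _ m); [assumption|lia|assumption]).
  assert (B1 : forall l Z, bigO P e 1 (fun i => e i * (l + t i * Z))).
  { intros l Z. apply bigO_ext with (fun i => e i ^ 1 * (l + t i * Z)); [intros; ring|].
    apply bigO_pow_mult; [assumption|]. bounded. }
  assert (Bp : bigO P e 1 p)
    by (apply (approx_bigO _ _ (S n) 1 _ _ He ltac:(lia) Hp), B1).
  assert (Bq : bigO P e 1 q)
    by (apply (approx_bigO _ _ (S n) 1 _ _ He ltac:(lia) Hq), B1).
  assert (BA : bigO P e 0 (fun i => A0 + t i * A1)) by bounded.
  apply approx_trans with (fun i => (A0 + t i * A1)
    * (e i * (h + t i * X)) * (e i * (k + t i * Y))).
  - apply (approx_mult P e _ (S n) 1 1 (S n)); auto; try lia.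
    + apply (approx_mult P e _ n 1 0 (S n)); auto; lia.
    + apply (bigO_mult P e 0 1); [assumption|apply B1].
  (* What the linearization drops contains t^2, hence is of order 2 + 2 m. *)
  - apply bigO_ext with (fun i => e i ^ 2 * ((t i * t i) *
      (A1 * (h * Y + k * X) + A0 * X * Y + t i * A1 * X * Y))); [intros; ring|].
    apply (bigO_le _ _ (2 + ((m + m) + 0))); [assumption|lia|].
    apply bigO_mult; [apply bigO_pow, He|].
    apply bigO_mult; [apply bigO_mult; assumption|]. bounded.
Qed.

Definition quad_at (a b c h k : R) : R := a * h * h + b * h * k + c * k * k.

(** Derivative of the form [quad_at a b c] at (h, k) in the direction (X, Y). *)
Definition dquad_at (a b c h k X Y : R) : R :=
  2 * a * h * X + b * (h * Y + k * X) + 2 * c * k * Y.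

Lemma quad_approx {A} (P : A -> Prop) e n m t a b c x y p q A0 B0 C0 A1 B1 C1 h k X Y :
  scale P e -> bigO P e m t -> (n <= m + m)%nat ->
  approx P e n (fun i => a (x i) (y i)) (fun i => A0 + t i * A1) ->
  approx P e n (fun i => b (x i) (y i)) (fun i => B0 + t i * B1) ->
  approx P e n (fun i => c (x i) (y i)) (fun i => C0 + t i * C1) ->
  approx P e (S n) p (fun i => e i * (h + t i * X)) ->
  approx P e (S n) q (fun i => e i * (k + t i * Y)) ->
  approx P e (S (S n)) (fun i => quad a b c (x i) (y i) (p i) (q i))
    (fun i => e i ^ 2 * (quad_at A0 B0 C0 h k
       + t i * (quad_at A1 B1 C1 h k + dquad_at A0 B0 C0 h k X Y))).
Proof.
  intros He Ht Hn Ha Hb Hc Hp Hq.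
  assert (T1 := term_approx P e n m t _ p p A0 A1 h h X X He Ht Hn Ha Hp Hp).
  assert (T2 := term_approx P e n m t _ p q B0 B1 h k X Y He Ht Hn Hb Hp Hq).
  assert (T3 := term_approx P e n m t _ q q C0 C1 k k Y Y He Ht Hn Hc Hq Hq).
  eapply bigO_ext; [|exact (approx_plus _ _ _ _ _ _ _ (approx_plus _ _ _ _ _ _ _ T1 T2) T3)].
  intros i _. unfold quad, quad_at, dquad_at. ring.
Qed.

(** * Bootstrapped expansions along all short solutions *)

Record sample := Sample { scl : R; crv : curve; tim : R }.

(** The index set of the expansions: a scale, any solution at that scale, and a time in [-1, 1].
    Letting the time vary makes the estimates uniform on the interval, as integrating them
    requires. *)
Definition sampled (u0 v0 r : R) (a1 b1 c1 a2 b2 c2 : R -> R -> R) (M h k e0 : R)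
    (a : sample) : Prop :=
  0 < scl a < e0 /\ -1 <= tim a <= 1 /\
  bvp_solution u0 v0 r a1 b1 c1 a2 b2 c2 M h k (scl a) (crv a).

Definition at_sample (f : curve -> R -> R) (a : sample) : R := f (crv a) (tim a).

Definition along (f : R -> R -> R) (a : sample) : R := f (at_sample cx a) (at_sample cy a).

(* Integrating a uniform expansion of the acceleration twice, the boundary values
   fix the integration constants. *)
Lemma integrate_expansion (P : sample -> Prop) e0 (X V Z : curve -> R -> R) w0 l Z0 Z1 n :
  (forall a, P a -> 0 < scl a < e0 /\ -1 <= tim a <= 1) ->
  (forall a t, P a -> -1 <= t <= 1 -> P (Sample (scl a) (crv a) t)) ->
  (forall a, P a -> X (crv a) (-1) = w0 - scl a * l /\ X (crv a) 1 = w0 + scl a * l) ->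
  (forall a, P a -> derivable_pt_lim (X (crv a)) (tim a) (V (crv a) (tim a)) /\
                    derivable_pt_lim (V (crv a)) (tim a) (Z (crv a) (tim a))) ->
  approx P scl n (at_sample Z) (fun a => scl a ^ 2 * Z0 + scl a ^ 3 * tim a * Z1) ->
  approx P scl n (at_sample X) (fun a => w0 + scl a * tim a * l
     + scl a ^ 2 * Z0 * (tim a ^ 2 - 1) / 2 + scl a ^ 3 * Z1 * (tim a ^ 3 - tim a) / 6) /\
  approx P scl n (at_sample V) (fun a => scl a * l + scl a ^ 2 * Z0 * tim a
     + scl a ^ 3 * Z1 * (3 * tim a ^ 2 - 1) / 6).
Proof.
  intros Hr Hs Hb Hd [C HC].
  assert (Key : forall a, P a ->
    Rabs (V (crv a) (tim a) - (scl a * l + scl a ^ 2 * Z0 * tim a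
      + scl a ^ 3 * Z1 * (3 * tim a ^ 2 - 1) / 6)) <= 3 * (C * scl a ^ n) /\
    Rabs (X (crv a) (tim a) - (w0 + scl a * tim a * l
     + scl a ^ 2 * Z0 * (tim a ^ 2 - 1) / 2 + scl a ^ 3 * Z1 * (tim a ^ 3 - tim a) / 6))
     <= 9 * (C * scl a ^ n)).
  { intros a Pa. destruct (Hr a Pa) as [He Ht]. destruct (Hb a Pa) as [Hm Hp].
    assert (Hda : forall t, -1 <= t <= 1 ->
      derivable_pt_lim (X (crv a)) t (V (crv a) t) /\
      derivable_pt_lim (V (crv a)) t (Z (crv a) t) /\
      Rabs (Z (crv a) t - (scl a ^ 2 * Z0 + scl a ^ 3 * t * Z1)) <= C * scl a ^ n).
    { intros t It. pose proof (Hs a t Pa It) as Pt.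
      destruct (Hd _ Pt) as [H1 H2]. split; [exact H1|]. split; [exact H2|].
      exact (HC _ Pt). }
    set (e := scl a) in *. set (c := crv a) in *.
    (* The difference from the cubic polynomial in time vanishes at -1 and 1, and its second
       derivative is the remainder of [Z]. *)
    apply (boundary_value_bound 1
      (fun t => X c t - (w0 + e * t * l
         + e ^ 2 * Z0 * (t ^ 2 - 1) / 2 + e ^ 3 * Z1 * (t ^ 3 - t) / 6))
      (fun t => V c t - (e * l + e ^ 2 * Z0 * t + e ^ 3 * Z1 * (3 * t ^ 2 - 1) / 6))
      (fun t => Z c t - (e ^ 2 * Z0 + e ^ 3 * t * Z1))).
    - lra.
    - intros t It.
      apply (derivable_pt_lim_minus (X c) (fun t => w0 + e * t * l
         + e ^ 2 * Z0 * (t ^ 2 - 1) / 2 + e ^ 3 * Z1 * (t ^ 3 - t) / 6)).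
      + apply Hda, It.
      + apply is_derive_Reals. auto_derive; [exact I|field].
    - intros t It.
      apply (derivable_pt_lim_minus (V c) (fun t => e * l + e ^ 2 * Z0 * t
         + e ^ 3 * Z1 * (3 * t ^ 2 - 1) / 6)).
      + apply Hda, It.
      + apply is_derive_Reals. auto_derive; [exact I|field].
    - intros t It. apply Hda, It.
    - rewrite Hm. field.
    - rewrite Hp. field.
    - assumption. }
  split.
  - exists (9 * C). intros a Pa. rewrite (Rmult_assoc _ C). exact (proj2 (Key a Pa)).
  - exists (3 * C). intros a Pa. rewrite (Rmult_assoc _ C). exact (proj1 (Key a Pa)).
Qed.

Definition taylor1 u0 v0 r K (f : R -> R -> R) l m : Prop :=
  forall u v, in_square u0 v0 r u v ->
    Rabs (f u v - f u0 v0 - l * (u - u0) - m * (v - v0))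
      <= K * (Rabs (u - u0) + Rabs (v - v0)) ^ 2.

Lemma bigO_sub {A} (P P' : A -> Prop) e n f :
  (forall a, P' a -> P a) -> bigO P e n f -> bigO P' e n f.
Proof. intros H [C HC]. exists C. auto. Qed.

Lemma bigO_abs_le {A} (P : A -> Prop) e n K f g :
  (forall a, P a -> Rabs (f a) <= K * Rabs (g a)) -> bigO P e n g -> bigO P e n f.
Proof.
  intros H [C HC]. exists (Rabs K * C). intros a Pa.
  eapply Rle_trans; [apply H, Pa|].
  apply Rle_trans with (Rabs K * Rabs (g a)).
  - apply Rmult_le_compat_r; [apply Rabs_pos|apply Rle_abs].
  - rewrite Rmult_assoc. apply Rmult_le_compat_l; [apply Rabs_pos|auto].
Qed.

Lemma bigO_Rabs {A} (P : A -> Prop) e n f :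
  bigO P e n f -> bigO P e n (fun a => Rabs (f a)).
Proof. intros [C HC]. exists C. intros a Pa. rewrite Rabs_Rabsolu. auto. Qed.

Lemma along_tame_approx (P : sample -> Prop) u0 v0 r K f :
  tame u0 v0 r K f -> 0 < r ->
  (forall a, P a -> in_square u0 v0 r (at_sample cx a) (at_sample cy a)) ->
  bigO P scl 1 (fun a => at_sample cx a - u0) -> bigO P scl 1 (fun a => at_sample cy a - v0) ->
  approx P scl 1 (along f) (fun _ => f u0 v0).
Proof.
  intros [_ Hl] rpos HS Hx Hy.
  apply bigO_abs_le with K (fun a => Rabs (at_sample cx a - u0) + Rabs (at_sample cy a - v0)).
  - intros a Pa. unfold along.
    rewrite (Rabs_pos_eq (Rabs (at_sample cx a - u0) + Rabs (at_sample cy a - v0))).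
    + apply Hl; [apply in_square_center, rpos|apply HS, Pa].
    + pose proof (Rabs_pos (at_sample cx a - u0)). pose proof (Rabs_pos (at_sample cy a - v0)). lra.
  - apply bigO_plus; apply bigO_Rabs; assumption.
Qed.

(** A displacement of order j leaves a Taylor remainder of order 2 j, whence n <= 2 j; the condition
    j <= n ensures that the true displacement is of order j as well. *)
Lemma along_taylor_approx (P : sample -> Prop) u0 v0 r K f l m n j dx dy :
  scale P scl -> taylor1 u0 v0 r K f l m ->
  (forall a, P a -> in_square u0 v0 r (at_sample cx a) (at_sample cy a)) ->
  approx P scl n (at_sample cx) (fun a => u0 + dx a) ->
  approx P scl n (at_sample cy) (fun a => v0 + dy a) ->
  bigO P scl j dx -> bigO P scl j dy -> (j <= n <= j + j)%nat ->
  approx P scl n (along f) (fun a => f u0 v0 + (l * dx a + m * dy a)).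
Proof.
  intros He HT HS Hx Hy Bx By Hn.
  assert (Ox : bigO P scl j (fun a => at_sample cx a - u0)).
  { apply bigO_ext with (fun a => (at_sample cx a - (u0 + dx a)) + dx a); [intros; ring|].
    apply bigO_plus; [|assumption]. apply (bigO_le _ _ n); [assumption|lia|assumption]. }
  assert (Oy : bigO P scl j (fun a => at_sample cy a - v0)).
  { apply bigO_ext with (fun a => (at_sample cy a - (v0 + dy a)) + dy a); [intros; ring|].
    apply bigO_plus; [|assumption]. apply (bigO_le _ _ n); [assumption|lia|assumption]. }
  apply bigO_ext with (fun a =>
    (along f a - f u0 v0 - l * (at_sample cx a - u0) - m * (at_sample cy a - v0))
    + (l * (at_sample cx a - (u0 + dx a)) + m * (at_sample cy a - (v0 + dy a)))); [intros; ring|].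
  apply bigO_plus.
  - apply (bigO_le _ _ (j + j)); [assumption|lia|].
    apply bigO_abs_le with K (fun a => (Rabs (at_sample cx a - u0) + Rabs (at_sample cy a - v0))
                                  * (Rabs (at_sample cx a - u0) + Rabs (at_sample cy a - v0))).
    + intros a Pa.
      pose proof (Rabs_pos (at_sample cx a - u0)). pose proof (Rabs_pos (at_sample cy a - v0)).
      rewrite (Rabs_pos_eq (_ * _)) by (apply Rmult_le_pos; lra).
      eapply Rle_trans; [apply HT, HS, Pa|]. right; ring.
    + apply bigO_mult; apply bigO_plus; apply bigO_Rabs; assumption.
  - apply bigO_plus; apply (bigO_mult _ _ 0 n); try assumption; apply bigO_const.
Qed.

Lemma sampled_time u0 v0 r a1 b1 c1 a2 b2 c2 M h k e0 a t :
  sampled u0 v0 r a1 b1 c1 a2 b2 c2 M h k e0 a -> -1 <= t <= 1 ->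
  sampled u0 v0 r a1 b1 c1 a2 b2 c2 M h k e0 (Sample (scl a) (crv a) t).
Proof. intros (H1 & H2 & H3) Ht. split; [exact H1|]. split; [exact Ht|exact H3]. Qed.

Lemma sampled_expand u0 v0 r a1 b1 c1 a2 b2 c2 M h k e0 n X0 X1 Y0 Y1 :
  let P := sampled u0 v0 r a1 b1 c1 a2 b2 c2 M h k e0 in
  approx P scl n (at_sample ax) (fun a => scl a ^ 2 * X0 + scl a ^ 3 * tim a * X1) ->
  approx P scl n (at_sample ay) (fun a => scl a ^ 2 * Y0 + scl a ^ 3 * tim a * Y1) ->
  (approx P scl n (at_sample cx) (fun a => u0 + scl a * tim a * h
     + scl a ^ 2 * X0 * (tim a ^ 2 - 1) / 2 + scl a ^ 3 * X1 * (tim a ^ 3 - tim a) / 6) /\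
  approx P scl n (at_sample vx) (fun a => scl a * h + scl a ^ 2 * X0 * tim a
     + scl a ^ 3 * X1 * (3 * tim a ^ 2 - 1) / 6)) /\
  (approx P scl n (at_sample cy) (fun a => v0 + scl a * tim a * k
     + scl a ^ 2 * Y0 * (tim a ^ 2 - 1) / 2 + scl a ^ 3 * Y1 * (tim a ^ 3 - tim a) / 6) /\
  approx P scl n (at_sample vy) (fun a => scl a * k + scl a ^ 2 * Y0 * tim a
     + scl a ^ 3 * Y1 * (3 * tim a ^ 2 - 1) / 6)).
Proof.
  intros P HX HY. split.
  - apply (integrate_expansion P e0 cx vx ax); [| | | |exact HX].
    + intros a (H1 & H2 & _). auto.
    + intros a t Pa Ht. apply sampled_time; assumption.
    + intros a (_ & _ & [Hb _]). tauto.
    + intros a (_ & Ht & [_ Hs]). destruct (Hs (tim a) ltac:(lra)) as (_ & H1 & H2 & _).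
      tauto.
  - apply (integrate_expansion P e0 cy vy ay); [| | | |exact HY].
    + intros a (H1 & H2 & _). auto.
    + intros a t Pa Ht. apply sampled_time; assumption.
    + intros a (_ & _ & [Hb _]). tauto.
    + intros a (_ & Ht & [_ Hs]). destruct (Hs (tim a) ltac:(lra)) as (_ & H1 & H2 & _).
      tauto.
Qed.

Lemma sampled_scale u0 v0 r a1 b1 c1 a2 b2 c2 M h k e0 : e0 <= 1 ->
  scale (sampled u0 v0 r a1 b1 c1 a2 b2 c2 M h k e0) scl.
Proof. intros He a (H1 & _). lra. Qed.

Lemma sampled_tim u0 v0 r a1 b1 c1 a2 b2 c2 M h k e0 :
  bigO (sampled u0 v0 r a1 b1 c1 a2 b2 c2 M h k e0) scl 0 tim.
Proof. exists 1. intros a (_ & Ht & _). simpl. apply Rabs_le; lra. Qed.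

Lemma sampled_in_square u0 v0 r a1 b1 c1 a2 b2 c2 M h k e0 a :
  sampled u0 v0 r a1 b1 c1 a2 b2 c2 M h k e0 a ->
  in_square u0 v0 r (at_sample cx a) (at_sample cy a).
Proof. intros (_ & Ht & [_ Hs]). apply Hs; lra. Qed.

Lemma bigO_self {A} (P : A -> Prop) e : scale P e -> bigO P e 1 e.
Proof.
  intros He. apply bigO_ext with (fun a => e a ^ 1); [intros; ring|apply bigO_pow, He].
Qed.

(** Start of the bootstrap: by the a priori bound the accelerations are 0 up to order 2, and
    integration gives the straight motion. *)
Lemma sampled_order1 u0 v0 r a1 b1 c1 a2 b2 c2 M h k e0 : e0 <= 1 ->
  let P := sampled u0 v0 r a1 b1 c1 a2 b2 c2 M h k e0 in
  (approx P scl 2 (at_sample cx) (fun a => u0 + scl a * tim a * h) /\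
   approx P scl 2 (at_sample vx) (fun a => scl a * h)) /\
  (approx P scl 2 (at_sample cy) (fun a => v0 + scl a * tim a * k) /\
   approx P scl 2 (at_sample vy) (fun a => scl a * k)).
Proof.
  intros He P.
  assert (Hx : approx P scl 2 (at_sample ax) (fun a => scl a ^ 2 * 0 + scl a ^ 3 * tim a * 0)).
  { exists M. intros a (_ & Ht & [_ Hs]).
    destruct (Hs (tim a) ltac:(lra)) as (_ & _ & _ & _ & H & _).
    replace (_ - _) with (ax (crv a) (tim a)) by (unfold at_sample; ring). exact H. }
  assert (Hy : approx P scl 2 (at_sample ay) (fun a => scl a ^ 2 * 0 + scl a ^ 3 * tim a * 0)).
  { exists M. intros a (_ & Ht & [_ Hs]).
    destruct (Hs (tim a) ltac:(lra)) as (_ & _ & _ & _ & _ & H).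
    replace (_ - _) with (ay (crv a) (tim a)) by (unfold at_sample; ring). exact H. }
  destruct (sampled_expand _ _ _ _ _ _ _ _ _ _ _ _ _ _ _ _ _ _ Hx Hy)
    as [[H1 H2] [H3 H4]].
  split; split;
    [eapply bigO_ext; [|exact H1] | eapply bigO_ext; [|exact H2]
    |eapply bigO_ext; [|exact H3] | eapply bigO_ext; [|exact H4]];
    intros; simpl; field.
Qed.

Lemma sampled_position_bigO u0 v0 r a1 b1 c1 a2 b2 c2 M h k e0 : e0 <= 1 ->
  let P := sampled u0 v0 r a1 b1 c1 a2 b2 c2 M h k e0 in
  bigO P scl 1 (fun a => at_sample cx a - u0) /\ bigO P scl 1 (fun a => at_sample cy a - v0).
Proof.
  intros He P.
  destruct (sampled_order1 u0 v0 r a1 b1 c1 a2 b2 c2 M h k e0 He) as [[H1 _] [H2 _]].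
  fold P in H1, H2.
  assert (Hs : scale P scl) by (apply sampled_scale, He).
  assert (Ht : bigO P scl 0 tim) by apply sampled_tim.
  split.
  - apply bigO_ext with (fun a => (at_sample cx a - (u0 + scl a * tim a * h)) + scl a ^ 1 * (tim a * h));
      [intros; ring|].
    apply bigO_plus; [apply (bigO_le _ _ 2); auto|].
    apply bigO_pow_mult; [assumption|]. bounded.
  - apply bigO_ext with (fun a => (at_sample cy a - (v0 + scl a * tim a * k)) + scl a ^ 1 * (tim a * k));
      [intros; ring|].
    apply bigO_plus; [apply (bigO_le _ _ 2); auto|].
    apply bigO_pow_mult; [assumption|]. bounded.
Qed.

Lemma approx_ext {A} (P : A -> Prop) e n f g f' g' :
  (forall a, P a -> f a = f' a) -> (forall a, P a -> g a = g' a) ->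
  approx P e n f g -> approx P e n f' g'.
Proof.
  intros Hf Hg. apply bigO_ext. intros a Pa. rewrite Hf, Hg; auto.
Qed.

(** The straight motion is inserted in an arbitrary form with Lipschitz coefficients. Applied to the
    spray coefficients this expands the accelerations, applied to E, 2 F, G the energy. *)
Lemma sampled_quad_order2 u0 v0 r a1 b1 c1 a2 b2 c2 M h k e0 K a b c : e0 <= 1 -> 0 < r ->
  tame u0 v0 r K a -> tame u0 v0 r K b -> tame u0 v0 r K c ->
  approx (sampled u0 v0 r a1 b1 c1 a2 b2 c2 M h k e0) scl 3
    (fun s => quad a b c (at_sample cx s) (at_sample cy s) (at_sample vx s) (at_sample vy s))
    (fun s => scl s ^ 2 * quad_at (a u0 v0) (b u0 v0) (c u0 v0) h k).
Proof.
  intros He rpos Ta Tb Tc. set (P := sampled _ _ _ _ _ _ _ _ _ _ _ _ _).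
  assert (Hs : scale P scl) by (apply sampled_scale, He).
  destruct (sampled_order1 u0 v0 r a1 b1 c1 a2 b2 c2 M h k e0 He) as [[_ Vx] [_ Vy]].
  destruct (sampled_position_bigO u0 v0 r a1 b1 c1 a2 b2 c2 M h k e0 He) as [Ox Oy].
  fold P in Vx, Vy, Ox, Oy.
  assert (Al : forall f, tame u0 v0 r K f ->
     approx P scl 1 (along f) (fun _ => f u0 v0 + 0 * 0)).
  { intros f Tf.
    apply approx_ext with (along f) (fun _ => f u0 v0); [reflexivity|intros; ring|].
    apply (along_tame_approx P u0 v0 r K); auto. intros s. apply sampled_in_square. }
  (* There is no linear term at this order: the small quantity is 0 and the derivative slots are
     filled with 0. *)
  eapply approx_ext; [reflexivity| |
    apply (quad_approx P scl 1 1 (fun _ => 0) a b c (at_sample cx) (at_sample cy) (at_sample vx) (at_sample vy)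
      (a u0 v0) (b u0 v0) (c u0 v0) 0 0 0 h k 0 0);
      [assumption| |lia|apply Al, Ta|apply Al, Tb|apply Al, Tc| | ]].
  - intros; simpl; ring.
  - exists 0. intros. rewrite Rabs_R0. lra.
  - eapply approx_ext; [reflexivity| |exact Vx]. intros; simpl; ring.
  - eapply approx_ext; [reflexivity| |exact Vy]. intros; simpl; ring.
Qed.

Lemma sampled_acceleration u0 v0 r a1 b1 c1 a2 b2 c2 M h k e0 a :
  sampled u0 v0 r a1 b1 c1 a2 b2 c2 M h k e0 a ->
  quad a1 b1 c1 (at_sample cx a) (at_sample cy a) (at_sample vx a) (at_sample vy a) = at_sample ax a /\
  quad a2 b2 c2 (at_sample cx a) (at_sample cy a) (at_sample vx a) (at_sample vy a) = at_sample ay a.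
Proof.
  intros (_ & Ht & [_ Hb]). destruct (Hb (tim a) ltac:(lra)) as (_ & _ & _ & [H H'] & _).
  split; symmetry; assumption.
Qed.

Lemma sampled_order2 u0 v0 r a1 b1 c1 a2 b2 c2 M h k e0 K : e0 <= 1 -> 0 < r ->
  tame u0 v0 r K a1 -> tame u0 v0 r K b1 -> tame u0 v0 r K c1 ->
  tame u0 v0 r K a2 -> tame u0 v0 r K b2 -> tame u0 v0 r K c2 ->
  let P := sampled u0 v0 r a1 b1 c1 a2 b2 c2 M h k e0 in
  let X0 := quad_at (a1 u0 v0) (b1 u0 v0) (c1 u0 v0) h k in
  let Y0 := quad_at (a2 u0 v0) (b2 u0 v0) (c2 u0 v0) h k in
  (approx P scl 3 (at_sample cx)
     (fun a => u0 + scl a * tim a * h + scl a ^ 2 * X0 * (tim a ^ 2 - 1) / 2) /\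
   approx P scl 3 (at_sample vx) (fun a => scl a * (h + scl a * tim a * X0))) /\
  (approx P scl 3 (at_sample cy)
     (fun a => v0 + scl a * tim a * k + scl a ^ 2 * Y0 * (tim a ^ 2 - 1) / 2) /\
   approx P scl 3 (at_sample vy) (fun a => scl a * (k + scl a * tim a * Y0))).
Proof.
  intros He rpos Ta1 Tb1 Tc1 Ta2 Tb2 Tc2 P X0 Y0.
  assert (HX : approx P scl 3 (at_sample ax) (fun a => scl a ^ 2 * X0 + scl a ^ 3 * tim a * 0)).
  { eapply approx_ext; [| |apply (sampled_quad_order2 u0 v0 r a1 b1 c1 a2 b2 c2 M h k e0 K
      a1 b1 c1); assumption].
    - intros a Pa. apply (sampled_acceleration _ _ _ _ _ _ _ _ _ _ _ _ _ _ Pa).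
    - intros; simpl; fold X0; ring. }
  assert (HY : approx P scl 3 (at_sample ay) (fun a => scl a ^ 2 * Y0 + scl a ^ 3 * tim a * 0)).
  { eapply approx_ext; [| |apply (sampled_quad_order2 u0 v0 r a1 b1 c1 a2 b2 c2 M h k e0 K
      a2 b2 c2); assumption].
    - intros a Pa. apply (sampled_acceleration _ _ _ _ _ _ _ _ _ _ _ _ _ _ Pa).
    - intros; simpl; fold Y0; ring. }
  destruct (sampled_expand _ _ _ _ _ _ _ _ _ _ _ _ _ _ _ _ _ _ HX HY)
    as [[H1 H2] [H3 H4]].
  split; split;
    [eapply bigO_ext; [|exact H1] | eapply bigO_ext; [|exact H2]
    |eapply bigO_ext; [|exact H3] | eapply bigO_ext; [|exact H4]];
    intros; simpl; field.
Qed.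

Definition tame_taylor u0 v0 r K f l m : Prop :=
  tame u0 v0 r K f /\ taylor1 u0 v0 r K f l m.

(** [X1] and [Y1] are the rates of change of the acceleration forms to first order along the motion:
    the coefficients vary with slope l h + m k, and the velocity (h, k) with slope ([X0], [Y0]). *)
Lemma sampled_order3 u0 v0 r a1 b1 c1 a2 b2 c2 M h k e0 K
    la1 ma1 lb1 mb1 lc1 mc1 la2 ma2 lb2 mb2 lc2 mc2 : e0 <= 1 -> 0 < r ->
  tame_taylor u0 v0 r K a1 la1 ma1 -> tame_taylor u0 v0 r K b1 lb1 mb1 ->
  tame_taylor u0 v0 r K c1 lc1 mc1 -> tame_taylor u0 v0 r K a2 la2 ma2 ->
  tame_taylor u0 v0 r K b2 lb2 mb2 -> tame_taylor u0 v0 r K c2 lc2 mc2 ->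
  let P := sampled u0 v0 r a1 b1 c1 a2 b2 c2 M h k e0 in
  let X0 := quad_at (a1 u0 v0) (b1 u0 v0) (c1 u0 v0) h k in
  let Y0 := quad_at (a2 u0 v0) (b2 u0 v0) (c2 u0 v0) h k in
  let X1 := quad_at (la1 * h + ma1 * k) (lb1 * h + mb1 * k) (lc1 * h + mc1 * k) h k
            + dquad_at (a1 u0 v0) (b1 u0 v0) (c1 u0 v0) h k X0 Y0 in
  let Y1 := quad_at (la2 * h + ma2 * k) (lb2 * h + mb2 * k) (lc2 * h + mc2 * k) h k
            + dquad_at (a2 u0 v0) (b2 u0 v0) (c2 u0 v0) h k X0 Y0 in
  approx P scl 4 (at_sample vx) (fun a => scl a * h + scl a ^ 2 * X0 * tim a
     + scl a ^ 3 * X1 * (3 * tim a ^ 2 - 1) / 6) /\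
  approx P scl 4 (at_sample vy) (fun a => scl a * k + scl a ^ 2 * Y0 * tim a
     + scl a ^ 3 * Y1 * (3 * tim a ^ 2 - 1) / 6).
Proof.
  intros He rpos [Ta1 La1] [Tb1 Lb1] [Tc1 Lc1] [Ta2 La2] [Tb2 Lb2] [Tc2 Lc2] P X0 Y0 X1 Y1.
  assert (Hs : scale P scl) by (apply sampled_scale, He).
  assert (Ht : bigO P scl 0 tim) by apply sampled_tim.
  destruct (sampled_order1 u0 v0 r a1 b1 c1 a2 b2 c2 M h k e0 He) as [[Px _] [Py _]].
  destruct (sampled_order2 u0 v0 r a1 b1 c1 a2 b2 c2 M h k e0 K He rpos
     Ta1 Tb1 Tc1 Ta2 Tb2 Tc2) as [[_ Vx] [_ Vy]].
  fold P X0 Y0 in Px, Py, Vx, Vy.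
  assert (Bst : bigO P scl 1 (fun a => scl a * tim a))
    by (apply (bigO_mult _ _ 1 0); [apply bigO_self, Hs|assumption]).
  assert (Al : forall f l m, taylor1 u0 v0 r K f l m -> approx P scl 2 (along f)
     (fun a => f u0 v0 + scl a * tim a * (l * h + m * k))).
  { intros f l m Hf.
    apply approx_ext with (along f)
      (fun a => f u0 v0 + (l * (scl a * tim a * h) + m * (scl a * tim a * k)));
      [reflexivity|intros; ring|].
    apply (along_taylor_approx P u0 v0 r K f l m 2 1); auto.
    - intros s. apply sampled_in_square.
    - apply (bigO_mult _ _ 1 0); [assumption|apply bigO_const].
    - apply (bigO_mult _ _ 1 0); [assumption|apply bigO_const]. }
  assert (HX : approx P scl 4 (at_sample ax) (fun a => scl a ^ 2 * X0 + scl a ^ 3 * tim a * X1)).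
  { eapply approx_ext; [| |apply (quad_approx P scl 2 1 (fun a => scl a * tim a)
      a1 b1 c1 (at_sample cx) (at_sample cy) (at_sample vx) (at_sample vy)); auto; [apply Al, La1|apply Al, Lb1|
        apply Al, Lc1|exact Vx|exact Vy]].
    - intros a Pa. apply (sampled_acceleration _ _ _ _ _ _ _ _ _ _ _ _ _ _ Pa).
    - intros; simpl; unfold X1, X0; ring. }
  assert (HY : approx P scl 4 (at_sample ay) (fun a => scl a ^ 2 * Y0 + scl a ^ 3 * tim a * Y1)).
  { eapply approx_ext; [| |apply (quad_approx P scl 2 1 (fun a => scl a * tim a)
      a2 b2 c2 (at_sample cx) (at_sample cy) (at_sample vx) (at_sample vy)); auto; [apply Al, La2|apply Al, Lb2|
        apply Al, Lc2|exact Vx|exact Vy]].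
    - intros a Pa. apply (sampled_acceleration _ _ _ _ _ _ _ _ _ _ _ _ _ _ Pa).
    - intros; simpl; unfold Y1, Y0; ring. }
  destruct (sampled_expand _ _ _ _ _ _ _ _ _ _ _ _ _ _ _ _ _ _ HX HY)
    as [[_ H2] [_ H4]].
  split; assumption.
Qed.

(** * Expansion of the conserved energy at the midpoint *)

Definition energy (E F G : R -> R -> R) (c : curve) (s : R) : R :=
  quad E (fun u v => 2 * F u v) G (cx c s) (cy c s) (vx c s) (vy c s).

Lemma energy_order2 u0 v0 r a1 b1 c1 a2 b2 c2 M h k e0 K E F G : e0 <= 1 -> 0 < r ->
  tame u0 v0 r K E -> tame u0 v0 r K (fun u v => 2 * F u v) -> tame u0 v0 r K G ->
  exists C, forall e c, 0 < e < e0 ->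
    bvp_solution u0 v0 r a1 b1 c1 a2 b2 c2 M h k e c ->
    Rabs (energy E F G c 0 - e ^ 2 * quad_at (E u0 v0) (2 * F u0 v0) (G u0 v0) h k)
      <= C * e ^ 3.
Proof.
  intros He rpos TE TF TG.
  destruct (sampled_quad_order2 u0 v0 r a1 b1 c1 a2 b2 c2 M h k e0 K _ _ _ He rpos TE TF TG)
    as [C HC].
  exists C. intros e c Ie Hc. apply (HC (Sample e c 0)).
  split; [exact Ie|]. split; [simpl; lra|exact Hc].
Qed.

(** At time 0 the position is m - (e^2 / 2) (X0, Y0) up to order 3, and the velocity is e ((h, k) -
    (e^2 / 6) (X1, Y1)) up to order 4. So e^2 itself serves as the small quantity of [quad_approx],
    with n = 3 and m = 2, and the error is of order 5. *)
Lemma energy_order4 u0 v0 r a1 b1 c1 a2 b2 c2 M h k e0 K E F G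
    la1 ma1 lb1 mb1 lc1 mc1 la2 ma2 lb2 mb2 lc2 mc2 lE mE lG mG : e0 <= 1 -> 0 < r ->
  tame_taylor u0 v0 r K a1 la1 ma1 -> tame_taylor u0 v0 r K b1 lb1 mb1 ->
  tame_taylor u0 v0 r K c1 lc1 mc1 -> tame_taylor u0 v0 r K a2 la2 ma2 ->
  tame_taylor u0 v0 r K b2 lb2 mb2 -> tame_taylor u0 v0 r K c2 lc2 mc2 ->
  taylor1 u0 v0 r K E lE mE -> taylor1 u0 v0 r K G lG mG ->
  (forall u v, in_square u0 v0 r u v -> F u v = 0) ->
  let X0 := quad_at (a1 u0 v0) (b1 u0 v0) (c1 u0 v0) h k in
  let Y0 := quad_at (a2 u0 v0) (b2 u0 v0) (c2 u0 v0) h k in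
  let X1 := quad_at (la1 * h + ma1 * k) (lb1 * h + mb1 * k) (lc1 * h + mc1 * k) h k
            + dquad_at (a1 u0 v0) (b1 u0 v0) (c1 u0 v0) h k X0 Y0 in
  let Y1 := quad_at (la2 * h + ma2 * k) (lb2 * h + mb2 * k) (lc2 * h + mc2 * k) h k
            + dquad_at (a2 u0 v0) (b2 u0 v0) (c2 u0 v0) h k X0 Y0 in
  exists C, forall e c, 0 < e < e0 ->
    bvp_solution u0 v0 r a1 b1 c1 a2 b2 c2 M h k e c ->
    Rabs (energy E F G c 0 - e ^ 2 * (quad_at (E u0 v0) 0 (G u0 v0) h k
      + e ^ 2 * (quad_at (- (lE * X0 + mE * Y0) / 2) 0 (- (lG * X0 + mG * Y0) / 2) h k
         + dquad_at (E u0 v0) 0 (G u0 v0) h k (- X1 / 6) (- Y1 / 6)))) <= C * e ^ 5.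
Proof.
  intros He rpos TTa1 TTb1 TTc1 TTa2 TTb2 TTc2 LE LG HF X0 Y0 X1 Y1.
  set (P := sampled u0 v0 r a1 b1 c1 a2 b2 c2 M h k e0).
  destruct (sampled_order2 u0 v0 r a1 b1 c1 a2 b2 c2 M h k e0 K He rpos
     (proj1 TTa1) (proj1 TTb1) (proj1 TTc1) (proj1 TTa2) (proj1 TTb2) (proj1 TTc2))
    as [[Px _] [Py _]].
  destruct (sampled_order3 u0 v0 r a1 b1 c1 a2 b2 c2 M h k e0 K _ _ _ _ _ _ _ _ _ _ _ _
    He rpos TTa1 TTb1 TTc1 TTa2 TTb2 TTc2) as [Vx Vy].
  fold P X0 Y0 in Px, Py, Vx, Vy. fold X1 in Vx. fold Y1 in Vy.
  pose (P0 := fun a => P a /\ tim a = 0).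
  assert (Sub : forall a, P0 a -> P a) by (intros a [H _]; exact H).
  assert (Hs : scale P0 scl).
  { intros a [Pa _]. exact (sampled_scale _ _ _ _ _ _ _ _ _ _ _ _ _ He a Pa). }
  assert (Px' : approx P0 scl 3 (at_sample cx) (fun a => u0 + scl a ^ 2 * (- X0 / 2))).
  { eapply approx_ext; [reflexivity| |exact (bigO_sub _ _ _ _ _ Sub Px)].
    intros a [_ Ha]. simpl. rewrite Ha. field. }
  assert (Py' : approx P0 scl 3 (at_sample cy) (fun a => v0 + scl a ^ 2 * (- Y0 / 2))).
  { eapply approx_ext; [reflexivity| |exact (bigO_sub _ _ _ _ _ Sub Py)].
    intros a [_ Ha]. simpl. rewrite Ha. field. }
  assert (Vx' : approx P0 scl 4 (at_sample vx) (fun a => scl a * (h + scl a ^ 2 * (- X1 / 6)))).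
  { eapply approx_ext; [reflexivity| |exact (bigO_sub _ _ _ _ _ Sub Vx)].
    intros a [_ Ha]. simpl. rewrite Ha. field. }
  assert (Vy' : approx P0 scl 4 (at_sample vy) (fun a => scl a * (k + scl a ^ 2 * (- Y1 / 6)))).
  { eapply approx_ext; [reflexivity| |exact (bigO_sub _ _ _ _ _ Sub Vy)].
    intros a [_ Ha]. simpl. rewrite Ha. field. }
  assert (InS : forall a, P0 a -> in_square u0 v0 r (at_sample cx a) (at_sample cy a)).
  { intros a [Pa _]. exact (sampled_in_square _ _ _ _ _ _ _ _ _ _ _ _ _ _ Pa). }
  assert (Al : forall f l m, taylor1 u0 v0 r K f l m -> approx P0 scl 3 (along f)
     (fun a => f u0 v0 + scl a ^ 2 * (- (l * X0 + m * Y0) / 2))).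
  { intros f l m Hf.
    apply approx_ext with (along f)
      (fun a => f u0 v0 + (l * (scl a ^ 2 * (- X0 / 2)) + m * (scl a ^ 2 * (- Y0 / 2))));
      [reflexivity|intros; field|].
    apply (along_taylor_approx P0 u0 v0 r K f l m 3 2); auto; try lia;
      (apply bigO_pow_mult; [assumption|apply bigO_const]). }
  assert (AF : approx P0 scl 3 (along (fun u v => 2 * F u v)) (fun a => 0 + scl a ^ 2 * 0)).
  { exists 0. intros a Pa. unfold along. rewrite HF by auto.
    replace (_ - _) with 0 by ring. rewrite Rabs_R0. lra. }
  destruct (quad_approx P0 scl 3 2 (fun a => scl a ^ 2) E (fun u v => 2 * F u v) G
    (at_sample cx) (at_sample cy) (at_sample vx) (at_sample vy) _ _ _ _ _ _ _ _ _ _ Hs (bigO_pow _ _ 2 Hs)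
    ltac:(lia) (Al _ _ _ LE) AF (Al _ _ _ LG) Vx' Vy') as [C HC].
  exists C. intros e c Ie Hc. apply (HC (Sample e c 0)).
  split; [|reflexivity]. split; [exact Ie|]. split; [simpl; lra|exact Hc].
Qed.

Lemma vanishing_coefficient n e0 C x : 0 < e0 ->
  (forall e, 0 < e < e0 -> Rabs (e ^ n * x) <= C * e ^ S n) -> x = 0.
Proof.
  intros He H. destruct (Req_dec x 0) as [|Hx]; [assumption|exfalso].
  assert (px := Rabs_pos_lt x Hx).
  assert (Hq : forall e, 0 < e < e0 -> Rabs x <= C * e).
  { intros e Ie. specialize (H e Ie).
    assert (0 < e ^ n) by (apply pow_lt; lra).
    rewrite Rabs_mult, (Rabs_pos_eq (e ^ n)) in H by lra. simpl in H.
    apply Rmult_le_reg_l with (e ^ n); [assumption|]. lra. }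
  assert (Cp : 0 < C).
  { pose proof (Hq (e0 / 2) ltac:(lra)). nra. }
  (* For this e the hypothesis gives |x| <= C e <= |x| / 2. *)
  set (e := Rmin (e0 / 2) (Rabs x / (2 * C))).
  assert (e <= Rabs x / (2 * C)) by apply Rmin_r.
  assert (e <= e0 / 2) by apply Rmin_l.
  assert (0 < Rabs x / (2 * C)) by (apply Rdiv_lt_0_compat; lra).
  assert (0 < e) by (unfold e; apply Rmin_pos; lra).
  pose proof (Hq e ltac:(lra)).
  assert (C * e <= C * (Rabs x / (2 * C))) by (apply Rmult_le_compat_l; lra).
  replace (C * (Rabs x / (2 * C))) with (Rabs x / 2) in * by (field; lra).
  lra.
Qed.

(** * Geodesics and their lengths *)

Definition C1_partials (D : R -> R -> Prop) (f fu fv : R -> R -> R) : Prop :=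
  partial_u D f fu /\ partial_v D f fv /\ cont2 D fu /\ cont2 D fv.

(* The Euler-Lagrange equations solved for the accelerations
   [x'' = a1 x'^2 + b1 x' y' + c1 y'^2] and [y'' = a2 x'^2 + b2 x' y' + c2 y'^2]. *)
Definition spray (D : R -> R -> Prop) (E F G Eu Ev Fu Fv Gu Gv : R -> R -> R)
    (a1 b1 c1 a2 b2 c2 : R -> R -> R) : Prop :=
  forall u v, D u v ->
    E u v * a1 u v + F u v * a2 u v = - Eu u v / 2 /\
    E u v * b1 u v + F u v * b2 u v = - Ev u v /\
    E u v * c1 u v + F u v * c2 u v = Gu u v / 2 - Fv u v /\
    F u v * a1 u v + G u v * a2 u v = Ev u v / 2 - Fu u v /\
    F u v * b1 u v + G u v * b2 u v = - Gu u v /\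
    F u v * c1 u v + G u v * c2 u v = - Gv u v / 2.

Lemma derivable_pt_lim_along D f fu fv X Y p q t : is_open2 D -> C1_partials D f fu fv ->
  D (X t) (Y t) -> derivable_pt_lim X t p -> derivable_pt_lim Y t q ->
  derivable_pt_lim (fun s => f (X s) (Y s)) t (fu (X t) (Y t) * p + fv (X t) (Y t) * q).
Proof.
  intros HD (Hu & Hv & Cu & Cv) HX Hp Hq.
  apply derivable_pt_lim_comp_2d; try assumption.
  apply (differentiable_pt_lim_partials D); assumption.
Qed.

(** Stated for two generic coefficients so as to serve both momenta, with (E, F) and with (F, G). *)
Lemma momentum_derive D E F Eu Ev Fu Fv X Y P Q t p' q' : is_open2 D ->
  C1_partials D E Eu Ev -> C1_partials D F Fu Fv -> D (X t) (Y t) ->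
  derivable_pt_lim X t (P t) -> derivable_pt_lim Y t (Q t) ->
  derivable_pt_lim P t p' -> derivable_pt_lim Q t q' ->
  derivable_pt_lim (fun s => E (X s) (Y s) * P s + F (X s) (Y s) * Q s) t
    ((Eu (X t) (Y t) * P t + Ev (X t) (Y t) * Q t) * P t + E (X t) (Y t) * p'
     + ((Fu (X t) (Y t) * P t + Fv (X t) (Y t) * Q t) * Q t + F (X t) (Y t) * q')).
Proof.
  intros HD HE HF HX DX DY DP DQ.
  apply (derivable_pt_lim_plus (fun s => E (X s) (Y s) * P s) (fun s => F (X s) (Y s) * Q s)).
  - apply (derivable_pt_lim_mult (fun s => E (X s) (Y s)) P); [|assumption].
    apply (derivable_pt_lim_along D); assumption.
  - apply (derivable_pt_lim_mult (fun s => F (X s) (Y s)) Q); [|assumption].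
    apply (derivable_pt_lim_along D); assumption.
Qed.

Lemma spray_acceleration D E F G Eu Ev Fu Fv Gu Gv a1 b1 c1 a2 b2 c2 x y p q :
  spray D E F G Eu Ev Fu Fv Gu Gv a1 b1 c1 a2 b2 c2 -> D x y ->
  E x y * quad a1 b1 c1 x y p q + F x y * quad a2 b2 c2 x y p q
    = - Eu x y / 2 * p * p - Ev x y * p * q + (Gu x y / 2 - Fv x y) * q * q /\
  F x y * quad a1 b1 c1 x y p q + G x y * quad a2 b2 c2 x y p q
    = (Ev x y / 2 - Fu x y) * p * p - Gu x y * p * q - Gv x y / 2 * q * q.
Proof.
  intros HS Dxy. destruct (HS x y Dxy) as (H1 & H2 & H3 & H4 & H5 & H6). unfold quad.
  split.
  - transitivity ((E x y * a1 x y + F x y * a2 x y) * p * p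
      + (E x y * b1 x y + F x y * b2 x y) * p * q
      + (E x y * c1 x y + F x y * c2 x y) * q * q); [ring|].
    rewrite H1, H2, H3. field.
  - transitivity ((F x y * a1 x y + G x y * a2 x y) * p * p
      + (F x y * b1 x y + G x y * b2 x y) * p * q
      + (F x y * c1 x y + G x y * c2 x y) * q * q); [ring|].
    rewrite H4, H5, H6. field.
Qed.

(** With the energy written as x' (E x' + F y') + y' (F x' + G y'), the product rule and the spray
    equations give a derivative that is cubic in the velocity, and all its terms cancel. *)
Lemma energy_constant D E F G Eu Ev Fu Fv Gu Gv u0 v0 r a1 b1 c1 a2 b2 c2 M h k e c :
  is_open2 D -> (forall u v, in_square u0 v0 r u v -> D u v) ->
  C1_partials D E Eu Ev -> C1_partials D F Fu Fv -> C1_partials D G Gu Gv ->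
  spray D E F G Eu Ev Fu Fv Gu Gv a1 b1 c1 a2 b2 c2 ->
  bvp_solution u0 v0 r a1 b1 c1 a2 b2 c2 M h k e c ->
  forall s, -2 <= s <= 2 -> energy E F G c s = energy E F G c 0.
Proof.
  intros HD Hr HE HF HG HS [_ Hc] s Is.
  apply Rminus_diag_uniq, Rabs_eq_0, Rle_antisym; [|apply Rabs_pos].
  apply Rle_trans with (0 * Rabs (s - 0)); [|right; apply Rmult_0_l].
  assert (Hin : forall t, Rmin 0 s <= t <= Rmax 0 s -> -2 <= t <= 2).
  { intros t. unfold Rmin, Rmax. destruct (Rle_dec 0 s); lra. }
  apply (mvt_bound (energy E F G c) (fun _ => 0)); [|intros; rewrite Rabs_R0; lra].
  intros t It. destruct (Hc t (Hin t It)) as (S & [DX DY] & [DP DQ] & [A1 A2] & _).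
  assert (Dt := Hr _ _ S).
  assert (M1 := momentum_derive D E F Eu Ev Fu Fv _ _ _ _ t _ _ HD HE HF Dt DX DY DP DQ).
  assert (M2 := momentum_derive D F G Fu Fv Gu Gv _ _ _ _ t _ _ HD HF HG Dt DX DY DP DQ).
  assert (H := derivable_pt_lim_plus _ _ _ _ _ (derivable_pt_lim_mult _ _ _ _ _ M1 DP)
    (derivable_pt_lim_mult _ _ _ _ _ M2 DQ)).
  apply is_derive_Reals. apply is_derive_Reals in H.
  destruct (spray_acceleration D E F G Eu Ev Fu Fv Gu Gv a1 b1 c1 a2 b2 c2 _ _
    (vx c t) (vy c t) HS Dt) as [S1 S2].
  rewrite <- A1, <- A2 in S1, S2.
  match type of H with is_derive _ _ ?l => replace 0 with l end.
  - eapply is_derive_ext; [|exact H]. intros w.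
    unfold energy, quad, plus_fct, mult_fct.
    match goal with |- ?l = ?m => change (l = m :> R) end. ring.
  - set (x := cx c t) in *. set (y := cy c t) in *.
    set (p := vx c t) in *. set (q := vy c t) in *.
    transitivity (2 * p * (E x y * ax c t + F x y * ay c t)
      + 2 * q * (F x y * ax c t + G x y * ay c t)
      + (Eu x y * p + Ev x y * q) * p * p + 2 * (Fu x y * p + Fv x y * q) * p * q
      + (Gu x y * p + Gv x y * q) * q * q); [ring|].
    rewrite S1, S2. field.
Qed.

Lemma derivable_pt_lim_reparam f t l : derivable_pt_lim f (2 * t - 1) l ->
  derivable_pt_lim (fun t => f (2 * t - 1)) t (2 * l).
Proof.
  intros H. rewrite Rmult_comm.
  apply (derivable_pt_lim_comp (fun t => 2 * t - 1) f); [|exact H].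
  apply is_derive_Reals. auto_derive; [exact I|ring].
Qed.

(** The substitution s = 2 t - 1 carries [0, 1] to [-1, 1] and (-1/2, 3/2) into [-2, 2]. Velocities
    double and both sides of the geodesic equations are multiplied by 4. *)
Lemma bvp_geodesic_segment D E F G Eu Ev Fu Fv Gu Gv u0 v0 r r' a1 b1 c1 a2 b2 c2 M h k e c :
  is_open2 D -> (forall u v, in_square u0 v0 r u v -> D u v) -> r <= r' ->
  C1_partials D E Eu Ev -> C1_partials D F Fu Fv -> C1_partials D G Gu Gv ->
  spray D E F G Eu Ev Fu Fv Gu Gv a1 b1 c1 a2 b2 c2 ->
  bvp_solution u0 v0 r a1 b1 c1 a2 b2 c2 M h k e c ->
  geodesic_segment_in D E F G u0 v0 r' (u0 - e * h) (v0 - e * k) (u0 + e * h) (v0 + e * k)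
    (- / 2) (3 / 2) (fun t => cx c (2 * t - 1)) (fun t => cy c (2 * t - 1))
    (fun t => 2 * vx c (2 * t - 1)) (fun t => 2 * vy c (2 * t - 1)).
Proof.
  intros HD Hr Hrr HE HF HG HS [(B1 & B2 & B3 & B4) Hc].
  split; [|split; [|split; [|split; [|split]]]].
  - split; [lra|]. split; [lra|]. split.
    + intros t It. destruct (Hc (2 * t - 1) ltac:(lra)) as (S & [DX DY] & _).
      split; [auto|]. split; apply derivable_pt_lim_reparam; assumption.
    + exists Eu, Ev, Fu, Fv, Gu, Gv.
      split; [apply HE|]. split; [apply HE|]. split; [apply HF|].
      split; [apply HF|]. split; [apply HG|]. split; [apply HG|].
      intros t It.
      destruct (Hc (2 * t - 1) ltac:(lra)) as (S & [DX DY] & [DP DQ] & [A1 A2] & _).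
      assert (Dt := Hr _ _ S).
      apply derivable_pt_lim_reparam in DX, DY, DP, DQ.
      apply (derivable_pt_lim_scal _ 2) in DP, DQ.
      assert (M1 := momentum_derive D E F Eu Ev Fu Fv (fun t => cx c (2 * t - 1))
         (fun t => cy c (2 * t - 1)) (fun t => 2 * vx c (2 * t - 1))
         (fun t => 2 * vy c (2 * t - 1)) t _ _ HD HE HF Dt DX DY DP DQ).
      assert (M2 := momentum_derive D F G Fu Fv Gu Gv (fun t => cx c (2 * t - 1))
         (fun t => cy c (2 * t - 1)) (fun t => 2 * vx c (2 * t - 1))
         (fun t => 2 * vy c (2 * t - 1)) t _ _ HD HF HG Dt DX DY DP DQ).
      destruct (spray_acceleration D E F G Eu Ev Fu Fv Gu Gv a1 b1 c1 a2 b2 c2 _ _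
        (vx c (2 * t - 1)) (vy c (2 * t - 1)) HS Dt) as [S1 S2].
      rewrite <- A1, <- A2 in S1, S2.
      cbv beta in M1, M2.
      set (x := cx c (2 * t - 1)) in *. set (y := cy c (2 * t - 1)) in *.
      set (p := vx c (2 * t - 1)) in *. set (q := vy c (2 * t - 1)) in *.
      set (p' := ax c (2 * t - 1)) in *. set (q' := ay c (2 * t - 1)) in *.
      split.
      * match type of M1 with derivable_pt_lim _ _ ?l =>
          match goal with |- derivable_pt_lim _ _ ?m => replace m with l end end;
          [exact M1|].
        transitivity (4 * (E x y * p' + F x y * q') + 4 * (Eu x y * p + Ev x y * q) * p
          + 4 * (Fu x y * p + Fv x y * q) * q); [ring|]. rewrite S1. field.
      * match type of M2 with derivable_pt_lim _ _ ?l =>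
          match goal with |- derivable_pt_lim _ _ ?m => replace m with l end end;
          [exact M2|].
        transitivity (4 * (F x y * p' + G x y * q') + 4 * (Fu x y * p + Fv x y * q) * p
          + 4 * (Gu x y * p + Gv x y * q) * q); [ring|]. rewrite S2. field.
  - rewrite <- B1. f_equal. ring.
  - rewrite <- B3. f_equal. ring.
  - rewrite <- B2. f_equal. ring.
  - rewrite <- B4. f_equal. ring.
  - intros t It. destruct (Hc (2 * t - 1) ltac:(lra)) as (S & _).
    apply (in_square_le _ _ r); assumption.
Qed.

(** By conservation the doubled velocity has constant squared norm, four times the energy at the
    midpoint, and the parameter interval has length 1. *)
Lemma bvp_length D E F G Eu Ev Fu Fv Gu Gv u0 v0 r a1 b1 c1 a2 b2 c2 M h k e c :
  is_open2 D -> (forall u v, in_square u0 v0 r u v -> D u v) ->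
  C1_partials D E Eu Ev -> C1_partials D F Fu Fv -> C1_partials D G Gu Gv ->
  spray D E F G Eu Ev Fu Fv Gu Gv a1 b1 c1 a2 b2 c2 ->
  bvp_solution u0 v0 r a1 b1 c1 a2 b2 c2 M h k e c ->
  exists pr : Riemann_integrable (speed E F G (fun t => cx c (2 * t - 1))
      (fun t => cy c (2 * t - 1)) (fun t => 2 * vx c (2 * t - 1))
      (fun t => 2 * vy c (2 * t - 1))) 0 1,
    RiemannInt pr = sqrt (4 * energy E F G c 0).
Proof.
  intros HD Hr HE HF HG HS Hc.
  assert (Hsp : forall t, Rmin 0 1 < t < Rmax 0 1 -> sqrt (4 * energy E F G c 0) =
    speed E F G (fun t => cx c (2 * t - 1)) (fun t => cy c (2 * t - 1))
      (fun t => 2 * vx c (2 * t - 1)) (fun t => 2 * vy c (2 * t - 1)) t).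
  { intros t. rewrite Rmin_left, Rmax_right by lra. intros It.
    rewrite <- (energy_constant D E F G Eu Ev Fu Fv Gu Gv u0 v0 r a1 b1 c1 a2 b2 c2 M h k e c
      HD Hr HE HF HG HS Hc (2 * t - 1) ltac:(lra)).
    unfold speed, energy, quad. f_equal. ring. }
  exists (ex_RInt_Reals_0 _ _ _ (ex_RInt_ext _ _ _ _ Hsp (ex_RInt_const _ _ _))).
  rewrite <- RInt_Reals, <- (RInt_ext _ _ _ _ Hsp), RInt_const.
  unfold scal; simpl; unfold mult; simpl. ring.
Qed.

(** Changing the sign of k turns one diagonal of the rectangle into the other. Lengths are square
    roots of energies, and positivity of the metric makes the energies nonnegative, so the roots can
    be compared. *)
Lemma ivory_energy_eq D E F G Eu Ev Fu Fv Gu Gv u0 v0 r r' a1 b1 c1 a2 b2 c2 M M' h k e c c' :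
  is_open2 D -> (forall u v, in_square u0 v0 r u v -> D u v) -> 0 < r -> r <= r' ->
  (forall u v, D u v -> 0 < E u v /\ 0 < E u v * G u v - F u v ^ 2) ->
  C1_partials D E Eu Ev -> C1_partials D F Fu Fv -> C1_partials D G Gu Gv ->
  spray D E F G Eu Ev Fu Fv Gu Gv a1 b1 c1 a2 b2 c2 ->
  ivory_near D E F G u0 v0 r' -> 0 < h -> 0 < k -> 0 < e ->
  bvp_solution u0 v0 r a1 b1 c1 a2 b2 c2 M h k e c ->
  bvp_solution u0 v0 r a1 b1 c1 a2 b2 c2 M' h (- k) e c' ->
  energy E F G c 0 = energy E F G c' 0.
Proof.
  intros HD Hr rpos Hrr Hpos HE HF HG HS HI Hh Hk He Hc Hc'.
  assert (G1 := bvp_geodesic_segment D E F G Eu Ev Fu Fv Gu Gv u0 v0 r r' _ _ _ _ _ _ _ _ _ _ _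
    HD Hr Hrr HE HF HG HS Hc).
  assert (G2 := bvp_geodesic_segment D E F G Eu Ev Fu Fv Gu Gv u0 v0 r r' _ _ _ _ _ _ _ _ _ _ _
    HD Hr Hrr HE HF HG HS Hc').
  replace (v0 - e * - k) with (v0 + e * k) in G2 by ring.
  replace (v0 + e * - k) with (v0 - e * k) in G2 by ring.
  destruct (bvp_length D E F G Eu Ev Fu Fv Gu Gv u0 v0 r _ _ _ _ _ _ _ _ _ _ _
    HD Hr HE HF HG HS Hc) as [pr Hpr].
  destruct (bvp_length D E F G Eu Ev Fu Fv Gu Gv u0 v0 r _ _ _ _ _ _ _ _ _ _ _
    HD Hr HE HF HG HS Hc') as [pr' Hpr'].
  assert (0 < e * h) by (apply Rmult_lt_0_compat; assumption).
  assert (0 < e * k) by (apply Rmult_lt_0_compat; assumption).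
  assert (HL := HI (u0 - e * h) (u0 + e * h) (v0 - e * k) (v0 + e * k) ltac:(lra) ltac:(lra) _ _ _ _ _ _ _ _ _ _ _ _ G1 G2 pr pr').
  rewrite Hpr, Hpr' in HL.
  assert (En : forall M h k c, bvp_solution u0 v0 r a1 b1 c1 a2 b2 c2 M h k e c ->
     0 <= energy E F G c 0).
  { intros M0 h0 k0 c0 [_ HB]. destruct (HB 0 ltac:(lra)) as (S & _).
    destruct (Hpos _ _ (Hr _ _ S)) as [P1 P2]. unfold energy, quad.
    set (x := cx c0 0) in *. set (y := cy c0 0) in *.
    set (p := vx c0 0). set (q := vy c0 0).
    apply Rmult_le_reg_l with (E x y); [assumption|]. rewrite Rmult_0_r.
    replace (E x y * _) with
      ((E x y * p + F x y * q) ^ 2 + (E x y * G x y - F x y ^ 2) * q ^ 2) by ring.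
    pose proof (pow2_ge_0 (E x y * p + F x y * q)). pose proof (pow2_ge_0 q). nra. }
  pose proof (En _ _ _ _ Hc). pose proof (En _ _ _ _ Hc').
  apply sqrt_inj in HL; lra.
Qed.

(** * Differential equations forced by the Ivory property *)

(** Serves to control the spray coefficients and the metric on one square with one constant. The
    bound 1 <= K is the one that [bvp_exists] asks for. *)
Lemma common_radius {A : Type} (Q : A -> R -> R -> Prop) (L : list A) :
  (forall a r K r' K', r' <= r -> K <= K' -> Q a r K -> Q a r' K') ->
  (forall a, In a L -> exists r K, 0 < r /\ Q a r K) ->
  exists r K, 0 < r /\ 1 <= K /\ forall a, In a L -> Q a r K.
Proof.
  intros Hm. induction L as [|b L IH]; intros HL.
  - exists 1, 1. split; [lra|]. split; [lra|]. intros a [].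
  - destruct IH as (r & K & rpos & K1 & HQ). { intros; apply HL; right; assumption. }
    destruct (HL b (or_introl eq_refl)) as (r' & K' & rpos' & Hb).
    exists (Rmin r r'), (Rmax K K').
    pose proof (Rmin_l r r'). pose proof (Rmin_r r r').
    pose proof (Rmax_l K K'). pose proof (Rmax_r K K').
    split; [apply Rmin_pos; assumption|]. split; [lra|].
    intros a [<-|Ha].
    + apply (Hm b r' K'); assumption.
    + apply (Hm a r K); auto.
Qed.

Lemma Ck2_C1_partials D f fu fv : partial_u D f fu -> partial_v D f fv ->
  Ck2 2 D fu -> Ck2 2 D fv -> C1_partials D f fu fv.
Proof.
  intros Hu Hv Cu Cv. split; [assumption|]. split; [assumption|].
  split; eapply Ck2_cont2; eassumption.
Qed.

Ltac ck2 := repeat (first [assumption | apply Ck2_const | apply Ck2_plus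
  | apply Ck2_mult | apply Ck2_inv]).

Lemma ivory_orthogonal D E F G : is_open2 D -> riemannian_metric D E F G ->
  ivory_property D E F G -> forall u v, D u v -> F u v = 0.
Proof.
  intros HD (SE & SF & SG & Hpos) HI u0 v0 Hm.
  assert (E2 := Ck2_pred 2 _ _ (SE 3%nat)). assert (F2 := Ck2_pred 2 _ _ (SF 3%nat)).
  assert (G2 := Ck2_pred 2 _ _ (SG 3%nat)).
  destruct (Ck2_partials 2 _ _ (SE 3%nat)) as (Eu & Ev & HEu & HEv & CEu & CEv).
  destruct (Ck2_partials 2 _ _ (SF 3%nat)) as (Fu & Fv & HFu & HFv & CFu & CFv).
  destruct (Ck2_partials 2 _ _ (SG 3%nat)) as (Gu & Gv & HGu & HGv & CGu & CGv).
  pose (W := fun u v => E u v * G u v + (-1) * (F u v * F u v)).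
  assert (W0 : forall u v, D u v -> W u v <> 0).
  { intros u v Duv. destruct (Hpos u v Duv). unfold W. simpl in *. lra. }
  assert (CW : Ck2 2 D W) by (unfold W; ck2).
  (* Cramer's rule: [s1] and [s2] solve the linear system with rows (E, F) and (F, G) and right-hand
     side ([al], [be]). The letters A, B, C below refer to the coefficients of x'^2, x' y' and
     y'^2. *)
  pose (s1 := fun (al be : R -> R -> R) u v =>
    (G u v * al u v + (-1) * (F u v * be u v)) * / W u v).
  pose (s2 := fun (al be : R -> R -> R) u v =>
    (E u v * be u v + (-1) * (F u v * al u v)) * / W u v).
  assert (Cs1 : forall al be, Ck2 2 D al -> Ck2 2 D be -> Ck2 2 D (s1 al be)).
  { intros al be Ha Hb. unfold s1. ck2. }
  assert (Cs2 : forall al be, Ck2 2 D al -> Ck2 2 D be -> Ck2 2 D (s2 al be)).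
  { intros al be Ha Hb. unfold s2. ck2. }
  assert (Hs : forall al be u v, D u v ->
     E u v * s1 al be u v + F u v * s2 al be u v = al u v /\
     F u v * s1 al be u v + G u v * s2 al be u v = be u v).
  { intros al be u v Duv. pose proof (W0 u v Duv) as Hw. unfold s1, s2, W in *.
    split; field; contradict Hw; lra. }
  pose (alA := fun u v => (-1/2) * Eu u v).
  pose (beA := fun u v => (1/2) * Ev u v + (-1) * Fu u v).
  pose (alB := fun u v => (-1) * Ev u v).
  pose (beB := fun u v => (-1) * Gu u v).
  pose (alC := fun u v => (1/2) * Gu u v + (-1) * Fv u v).
  pose (beC := fun u v => (-1/2) * Gv u v).
  assert (CalA : Ck2 2 D alA) by (unfold alA; ck2).
  assert (CbeA : Ck2 2 D beA) by (unfold beA; ck2).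
  assert (CalB : Ck2 2 D alB) by (unfold alB; ck2).
  assert (CbeB : Ck2 2 D beB) by (unfold beB; ck2).
  assert (CalC : Ck2 2 D alC) by (unfold alC; ck2).
  assert (CbeC : Ck2 2 D beC) by (unfold beC; ck2).
  assert (HS : spray D E F G Eu Ev Fu Fv Gu Gv (s1 alA beA) (s1 alB beB) (s1 alC beC)
     (s2 alA beA) (s2 alB beB) (s2 alC beC)).
  { intros u v Duv.
    destruct (Hs alA beA u v Duv) as [A1 A2]. destruct (Hs alB beB u v Duv) as [B1 B2].
    destruct (Hs alC beC u v Duv) as [C1 C2].
    rewrite A1, A2, B1, B2, C1, C2. unfold alA, beA, alB, beB, alC, beC.
    repeat split; field. }
  destruct (HI u0 v0 Hm) as (r' & rpos' & Hr' & Hiv).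
  pose (L := s1 alA beA :: s1 alB beB :: s1 alC beC :: s2 alA beA :: s2 alB beB
     :: s2 alC beC :: E :: (fun u v => 2 * F u v) :: G :: nil).
  destruct (common_radius (fun f r K => tame u0 v0 r K f) L) as (r1 & K & r1pos & K1 & HT).
  { intros; eapply tame_le; eassumption. }
  { intros f Hf. apply (Ck2_tame D); [assumption| |assumption].
    apply Ck2_pred. simpl in Hf.
    destruct Hf as [<-|[<-|[<-|[<-|[<-|[<-|[<-|[<-|[<-|[]]]]]]]]]]; auto. ck2. }
  set (r := Rmin r' r1).
  assert (rpos : 0 < r) by (apply Rmin_pos; assumption).
  assert (Hrr : r <= r') by apply Rmin_l.
  assert (HTr : forall f, In f L -> tame u0 v0 r K f).
  { intros f Hf. apply (tame_le u0 v0 r1 K); [apply Rmin_r|lra|exact (HT f Hf)]. }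
  clear HT.
  assert (Hr : forall u v, in_square u0 v0 r u v -> D u v).
  { intros u v S. apply Hr'. apply (in_square_le _ _ r); assumption. }
  destruct (bvp_exists u0 v0 r K (s1 alA beA) (s1 alB beB) (s1 alC beC)
     (s2 alA beA) (s2 alB beB) (s2 alC beC) rpos K1)
    as (e0 & [e0pos e01] & Hex); try (apply HTr; simpl; tauto).
  destruct (energy_order2 u0 v0 r (s1 alA beA) (s1 alB beB) (s1 alC beC)
     (s2 alA beA) (s2 alB beB) (s2 alC beC) (12 * K) 1 1 e0 K E F G e01 rpos)
    as [C HC]; try (apply HTr; simpl; tauto).
  destruct (energy_order2 u0 v0 r (s1 alA beA) (s1 alB beB) (s1 alC beC)
     (s2 alA beA) (s2 alB beB) (s2 alC beC) (12 * K) 1 (-1) e0 K E F G e01 rpos)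
    as [C' HC']; try (apply HTr; simpl; tauto).
  (* The metric form takes values at (1, 1) and (1, -1) that differ by 4 F. *)
  enough (4 * F u0 v0 = 0) by lra.
  apply (vanishing_coefficient 2 e0 (C + C')); [assumption|].
  intros e Ie.
  assert (R1 : Rabs 1 <= 1) by (rewrite Rabs_R1; lra).
  assert (R2 : Rabs (-1) <= 1) by (rewrite Rabs_m1; lra).
  destruct (Hex e 1 1 Ie R1 R1) as [c Hc].
  destruct (Hex e 1 (-1) Ie R1 R2) as [c' Hc'].
  specialize (HC e c Ie Hc). specialize (HC' e c' Ie Hc').
  assert (HE := Ck2_C1_partials _ _ _ _ HEu HEv CEu CEv).
  assert (HF := Ck2_C1_partials _ _ _ _ HFu HFv CFu CFv).
  assert (HG := Ck2_C1_partials _ _ _ _ HGu HGv CGu CGv).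
  assert (EQ := ivory_energy_eq D E F G Eu Ev Fu Fv Gu Gv u0 v0 r r' _ _ _ _ _ _ _ _
    1 1 e c c' HD Hr rpos Hrr Hpos HE HF HG HS Hiv Rlt_0_1 Rlt_0_1 (proj1 Ie) Hc Hc').
  rewrite EQ in HC.
  replace (e ^ 2 * (4 * F u0 v0)) with
    ((energy E F G c' 0 - e ^ 2 * quad_at (E u0 v0) (2 * F u0 v0) (G u0 v0) 1 (-1))
     - (energy E F G c' 0 - e ^ 2 * quad_at (E u0 v0) (2 * F u0 v0) (G u0 v0) 1 1))
    by (unfold quad_at; ring).
  eapply Rle_trans; [apply Rabs_triang|]. rewrite Rabs_Ropp. lra.
Qed.

Lemma derivable_pt_lim_scaled_ratio c f g x f' g' : g x <> 0 ->
  derivable_pt_lim f x f' -> derivable_pt_lim g x g' ->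
  derivable_pt_lim (fun t => c * (f t * / g t)) x (c * (f' / g x - f x * g' / g x ^ 2)).
Proof.
  intros Hg Hf Hg'.
  apply (derivable_pt_lim_scal (fun t => f t * / g t)).
  replace (f' / g x - f x * g' / g x ^ 2) with (f' * / g x + f x * (- g' / g x ^ 2))
    by (field; assumption).
  apply (derivable_pt_lim_mult f (fun t => / g t)); [assumption|].
  apply is_derive_Reals. apply is_derive_inv; [|assumption].
  apply is_derive_Reals; assumption.
Qed.

Lemma tame_taylor_le u0 v0 r K r' K' f l m : r' <= r -> K <= K' ->
  tame_taylor u0 v0 r K f l m -> tame_taylor u0 v0 r' K' f l m.
Proof.
  intros Hr HK [H1 H2]. split; [eapply tame_le; eassumption|].
  intros u v S. eapply Rle_trans; [apply H2; eapply in_square_le; eassumption|].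
  apply Rmult_le_compat_r; [apply pow2_ge_0|assumption].
Qed.

Lemma Ck2_tame_taylor D f u0 v0 l m : is_open2 D -> Ck2 2 D f -> D u0 v0 ->
  derivable_pt_lim (fun t => f t v0) u0 l -> derivable_pt_lim (fun t => f u0 t) v0 m ->
  exists r K, 0 < r /\ tame_taylor u0 v0 r K f l m.
Proof.
  intros HD Hf Hm Hl Hk.
  destruct (Ck2_tame D f u0 v0 HD (Ck2_pred _ _ _ Hf) Hm) as (r1 & K1 & r1p & H1).
  destruct (Ck2_taylor D f u0 v0 l m HD Hf Hm Hl Hk) as (r2 & K2 & r2p & H2).
  exists (Rmin r1 r2), (Rmax K1 K2). split; [apply Rmin_pos; assumption|]. split.
  - apply (tame_le u0 v0 r1 K1); [apply Rmin_l|apply Rmax_l|assumption].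
  - intros u v S. eapply Rle_trans.
    + apply H2. apply (in_square_le _ _ (Rmin r1 r2)); [apply Rmin_r|assumption].
    + apply Rmult_le_compat_r; [apply pow2_ge_0|apply Rmax_r].
Qed.

Lemma ivory_second_order D E F G Eu Ev Gu Gv Euu Euv Evu Evv Guu Guv Gvu Gvv u0 v0 r' :
  is_open2 D -> (forall u v, D u v -> 0 < E u v /\ 0 < E u v * G u v - F u v ^ 2) ->
  (forall u v, D u v -> F u v = 0) ->
  Ck2 2 D E -> Ck2 2 D G -> Ck2 2 D Eu -> Ck2 2 D Ev -> Ck2 2 D Gu -> Ck2 2 D Gv ->
  partial_u D E Eu -> partial_v D E Ev -> partial_u D G Gu -> partial_v D G Gv ->
  partial_u D Eu Euu -> partial_v D Eu Euv -> partial_u D Ev Evu -> partial_v D Ev Evv ->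
  partial_u D Gu Guu -> partial_v D Gu Guv -> partial_u D Gv Gvu -> partial_v D Gv Gvv ->
  Evu u0 v0 = Euv u0 v0 -> Gvu u0 v0 = Guv u0 v0 ->
  D u0 v0 -> 0 < r' -> (forall u v, in_square u0 v0 r' u v -> D u v) ->
  ivory_near D E F G u0 v0 r' ->
  Euv u0 v0 - Eu u0 v0 * Ev u0 v0 / E u0 v0 + Ev u0 v0 * Gu u0 v0 / G u0 v0 = 0 /\
  Guv u0 v0 - Gu u0 v0 * Gv u0 v0 / G u0 v0 + Ev u0 v0 * Gu u0 v0 / E u0 v0 = 0.
Proof.
  intros HD Hpos HF0 CE CG CEu CEv CGu CGv HEu HEv HGu HGv HEuu HEuv HEvu HEvv
    HGuu HGuv HGvu HGvv SE SG Hm rpos' Hr' Hiv.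
  assert (E0 : forall u v, D u v -> E u v <> 0) by (intros u v Duv; apply Hpos in Duv; lra).
  assert (G0 : forall u v, D u v -> G u v <> 0).
  { intros u v Duv. pose proof (Hpos u v Duv) as [P1 P2]. rewrite HF0 in P2 by assumption.
    intros Z. rewrite Z in P2. simpl in P2. lra. }
  (* F vanishes on an open set, so zero functions are its partials; the spray coefficients then
     reduce to quotients by E or G. *)
  assert (HF : C1_partials D F (fun _ _ => 0) (fun _ _ => 0)).
  { assert (Hloc : forall f : R -> R, forall x q, 0 < q ->
      (forall t, Rabs (t - x) < q -> f t = 0) -> derivable_pt_lim f x 0).
    { intros f x q qpos Hf. apply is_derive_Reals.
      apply is_derive_ext_loc with (fun _ => 0).
      - exists (mkposreal q qpos). intros t Ht. symmetry. apply Hf, Ht.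
      - apply is_derive_Reals, derivable_pt_lim_const. }
    assert (Cz : cont2 D (fun _ _ => 0)) by exact (Ck2_const 0 D 0).
    split; [|split; [|split; exact Cz]]; intros u v Duv;
      destruct (HD u v Duv) as [q [qpos Hq]]; apply (Hloc _ _ q qpos); intros t Ht;
      apply HF0, Hq; split; try assumption; rewrite Rminus_diag, Rabs_R0; assumption. }
  pose (a1 := fun u v => (-1/2) * (Eu u v * / E u v)).
  pose (b1 := fun u v => (-1) * (Ev u v * / E u v)).
  pose (c1 := fun u v => (1/2) * (Gu u v * / E u v)).
  pose (a2 := fun u v => (1/2) * (Ev u v * / G u v)).
  pose (b2 := fun u v => (-1) * (Gu u v * / G u v)).
  pose (c2 := fun u v => (-1/2) * (Gv u v * / G u v)).
  (* Derivative of the quotient c f / g; the list [J] uses it to attach to each spray coefficient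
     its two partials at the centre. *)
  pose (d := fun c f f' g g' : R => c * (f' / g - f * g' / g ^ 2)).
  set (E_ := E u0 v0) in *. set (G_ := G u0 v0) in *.
  set (Eu_ := Eu u0 v0) in *. set (Ev_ := Ev u0 v0) in *.
  set (Gu_ := Gu u0 v0) in *. set (Gv_ := Gv u0 v0) in *.
  pose (J := (a1, d (-1/2) Eu_ (Euu u0 v0) E_ Eu_, d (-1/2) Eu_ (Euv u0 v0) E_ Ev_)
    :: (b1, d (-1) Ev_ (Evu u0 v0) E_ Eu_, d (-1) Ev_ (Evv u0 v0) E_ Ev_)
    :: (c1, d (1/2) Gu_ (Guu u0 v0) E_ Eu_, d (1/2) Gu_ (Guv u0 v0) E_ Ev_)
    :: (a2, d (1/2) Ev_ (Evu u0 v0) G_ Gu_, d (1/2) Ev_ (Evv u0 v0) G_ Gv_)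
    :: (b2, d (-1) Gu_ (Guu u0 v0) G_ Gu_, d (-1) Gu_ (Guv u0 v0) G_ Gv_)
    :: (c2, d (-1/2) Gv_ (Gvu u0 v0) G_ Gu_, d (-1/2) Gv_ (Gvv u0 v0) G_ Gv_)
    :: (E, Eu_, Ev_) :: (G, Gu_, Gv_) :: nil).
  destruct (common_radius (fun j r K => tame_taylor u0 v0 r K (fst (fst j)) (snd (fst j)) (snd j))
    J) as (r1 & K & r1pos & K1 & HT).
  { intros; eapply tame_taylor_le; eassumption. }
  { assert (Hj : forall c f fu fv g gu gv, Ck2 2 D f -> Ck2 2 D g ->
      (forall u v, D u v -> g u v <> 0) -> partial_u D f fu -> partial_v D f fv ->
      partial_u D g gu -> partial_v D g gv ->
      exists r K, 0 < r /\ tame_taylor u0 v0 r K (fun u v => c * (f u v * / g u v))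
        (d c (f u0 v0) (fu u0 v0) (g u0 v0) (gu u0 v0))
        (d c (f u0 v0) (fv u0 v0) (g u0 v0) (gv u0 v0))).
    { intros c f fu fv g gu gv Cf Cg g0 Hfu Hfv Hgu Hgv.
      apply (Ck2_tame_taylor D); [assumption| |assumption| |].
      - ck2.
      - apply (derivable_pt_lim_scaled_ratio c (fun t => f t v0) (fun t => g t v0)); auto.
      - apply (derivable_pt_lim_scaled_ratio c (fun t => f u0 t) (fun t => g u0 t)); auto. }
    intros j Hin. simpl in Hin.
    destruct Hin as [<-|[<-|[<-|[<-|[<-|[<-|[<-|[<-|[]]]]]]]]]; simpl.
    - apply (Hj _ Eu Euu Euv E Eu Ev); assumption.
    - apply (Hj _ Ev Evu Evv E Eu Ev); assumption.
    - apply (Hj _ Gu Guu Guv E Eu Ev); assumption.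
    - apply (Hj _ Ev Evu Evv G Gu Gv); assumption.
    - apply (Hj _ Gu Guu Guv G Gu Gv); assumption.
    - apply (Hj _ Gv Gvu Gvv G Gu Gv); assumption.
    - apply (Ck2_tame_taylor D); auto.
    - apply (Ck2_tame_taylor D); auto. }
  set (r := Rmin r' r1).
  assert (rpos : 0 < r) by (apply Rmin_pos; assumption).
  assert (Hrr : r <= r') by apply Rmin_l.
  assert (HTr : forall j, In j J ->
    tame_taylor u0 v0 r K (fst (fst j)) (snd (fst j)) (snd j)).
  { intros j Hj. apply (tame_taylor_le u0 v0 r1 K); [apply Rmin_r|lra|exact (HT j Hj)]. }
  clear HT.
  assert (Ta1 := HTr _ (or_introl eq_refl)).
  assert (Tb1 := HTr _ (or_intror (or_introl eq_refl))).
  assert (Tc1 := HTr _ (or_intror (or_intror (or_introl eq_refl)))).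
  assert (Ta2 := HTr _ (or_intror (or_intror (or_intror (or_introl eq_refl))))).
  assert (Tb2 := HTr _ (or_intror (or_intror (or_intror (or_intror (or_introl eq_refl)))))).
  assert (Tc2 := HTr _ (or_intror (or_intror (or_intror (or_intror (or_intror
    (or_introl eq_refl))))))).
  assert (TE := HTr _ (or_intror (or_intror (or_intror (or_intror (or_intror (or_intror
    (or_introl eq_refl)))))))).
  assert (TG := HTr _ (or_intror (or_intror (or_intror (or_intror (or_intror (or_intror
    (or_intror (or_introl eq_refl))))))))).
  simpl fst in *. simpl snd in *. clear HTr J.
  assert (Hr : forall u v, in_square u0 v0 r u v -> D u v).
  { intros u v S. apply Hr'. apply (in_square_le _ _ r); assumption. }
  assert (HS : spray D E F G Eu Ev (fun _ _ => 0) (fun _ _ => 0) Gu Gv a1 b1 c1 a2 b2 c2).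
  { intros u v Duv. rewrite HF0 by assumption. unfold a1, b1, c1, a2, b2, c2.
    repeat split; field; auto. }
  destruct (bvp_exists u0 v0 r K a1 b1 c1 a2 b2 c2 rpos K1 (proj1 Ta1) (proj1 Tb1)
    (proj1 Tc1) (proj1 Ta2) (proj1 Tb2) (proj1 Tc2)) as (e0 & [e0pos e01] & Hex).
  assert (HE := Ck2_C1_partials _ _ _ _ HEu HEv CEu CEv).
  assert (HG := Ck2_C1_partials _ _ _ _ HGu HGv CGu CGv).
  assert (HFr : forall u v, in_square u0 v0 r u v -> F u v = 0) by auto.
  assert (nE := E0 u0 v0 Hm). assert (nG := G0 u0 v0 Hm). fold E_ in nE. fold G_ in nG.
  assert (Key : forall k, 0 < k <= 1 ->
    k * (Euv u0 v0 - Eu_ * Ev_ / E_ + Ev_ * Gu_ / G_)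
    + k ^ 3 * (Guv u0 v0 - Gu_ * Gv_ / G_ + Ev_ * Gu_ / E_) = 0).
  { intros k Ik.
    destruct (energy_order4 u0 v0 r a1 b1 c1 a2 b2 c2 (12 * K) 1 k e0 K E F G
      _ _ _ _ _ _ _ _ _ _ _ _ _ _ _ _ e01 rpos Ta1 Tb1 Tc1 Ta2 Tb2 Tc2
      (proj2 TE) (proj2 TG) HFr) as [C HC].
    destruct (energy_order4 u0 v0 r a1 b1 c1 a2 b2 c2 (12 * K) 1 (- k) e0 K E F G
      _ _ _ _ _ _ _ _ _ _ _ _ _ _ _ _ e01 rpos Ta1 Tb1 Tc1 Ta2 Tb2 Tc2
      (proj2 TE) (proj2 TG) HFr) as [C' HC'].
    (* The coefficient of e^4 in the difference of the expansions for k and - k is 2 / 3 times the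
       left-hand side; contributions even in k cancel. *)
    match goal with |- ?x = 0 => enough (2 / 3 * x = 0) by lra end.
    apply (vanishing_coefficient 4 e0 (C + C')); [assumption|]. intros e Ie.
    assert (R1 : Rabs 1 <= 1) by (rewrite Rabs_R1; lra).
    assert (Rk : Rabs k <= 1) by (apply Rabs_le; lra).
    assert (Rk' : Rabs (- k) <= 1) by (rewrite Rabs_Ropp; assumption).
    destruct (Hex e 1 k Ie R1 Rk) as [c Hc].
    destruct (Hex e 1 (- k) Ie R1 Rk') as [c' Hc'].
    specialize (HC e c Ie Hc). specialize (HC' e c' Ie Hc').
    assert (EQ := ivory_energy_eq D E F G Eu Ev _ _ Gu Gv u0 v0 r r' _ _ _ _ _ _ _ _
      1 k e c c' HD Hr rpos Hrr Hpos HE HF HG HS Hiv Rlt_0_1 (proj1 Ik) (proj1 Ie) Hc Hc').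
    rewrite EQ in HC.
    match type of HC with Rabs ?x <= _ => match type of HC' with Rabs ?y <= _ =>
      apply Rle_trans with (Rabs (y - x)) end end.
    (* The Taylor slopes of the spray coefficients contain mixed partials in both orders; symmetry
       merges them before the rational identity is checked. *)
    - right. f_equal. rewrite SE, SG. unfold quad_at, dquad_at, d, a1, b1, c1, a2, b2, c2.
      fold E_ G_ Eu_ Ev_ Gu_ Gv_. field. auto.
    - eapply Rle_trans; [apply Rabs_triang|]. rewrite Rabs_Ropp. lra. }
  (* Two values of k separate the equations: the pairs (k, k^3) = (1, 1) and (1/2, 1/8) are linearly
     independent. *)
  pose proof (Key 1 ltac:(lra)). pose proof (Key (/ 2) ltac:(lra)). lra.
Qed.

(** * Integration of the differential equations *)

Lemma zero_derivative_constant f c r t :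
  (forall s, Rabs (s - c) < r -> derivable_pt_lim f s 0) -> Rabs (t - c) < r -> f t = f c.
Proof.
  intros Hf Ht.
  apply Rminus_diag_uniq, Rabs_eq_0, Rle_antisym; [|apply Rabs_pos].
  apply Rle_trans with (0 * Rabs (t - c)); [|right; apply Rmult_0_l].
  apply (mvt_bound f (fun _ => 0)); [|intros; rewrite Rabs_R0; lra].
  intros s Is. apply Hf. apply (Rabs_between_center c r c t); try assumption.
  rewrite Rminus_diag, Rabs_R0. pose proof (Rabs_pos (t - c)). lra.
Qed.

Lemma derivable_pt_lim_ratio f g x f' g' : g x <> 0 ->
  derivable_pt_lim f x f' -> derivable_pt_lim g x g' ->
  derivable_pt_lim (fun t => f t / g t) x ((f' * g x - g' * f x) / Rsqr (g x)).
Proof. intros Hg Hf Hg'. exact (derivable_pt_lim_div f g x f' g' Hf Hg' Hg). Qed.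

(* The first equation says that [Ev * G / E] does not depend on [u]; with the second,
   the logarithmic derivative of [E / G] in [v] does not depend on [u] either. *)
Lemma liouville_of_pde u0 v0 r E G Eu Ev Gu Gv Euv Guv :
  let S := in_square u0 v0 r in 0 < r ->
  (forall u v, S u v -> 0 < E u v /\ 0 < G u v) ->
  partial_u S E Eu -> partial_v S E Ev -> partial_u S G Gu -> partial_v S G Gv ->
  partial_u S Ev Euv -> partial_u S Gv Guv ->
  (forall u v, S u v ->
     Euv u v - Eu u v * Ev u v / E u v + Ev u v * Gu u v / G u v = 0 /\
     Guv u v - Gu u v * Gv u v / G u v + Ev u v * Gu u v / E u v = 0) ->
  exists U1 U2 V1 V2 : R -> R, forall u v, S u v ->
    E u v = (U1 u - V1 v) * U2 u /\ G u v = (U1 u - V1 v) * V2 v.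
Proof.
  intros S rpos Hpos HEu HEv HGu HGv HEuv HGuv Hpde.
  assert (Nz : forall u v, S u v -> E u v <> 0 /\ G u v <> 0)
    by (intros u v H; apply Hpos in H; lra).
  assert (C0 : Rabs (u0 - u0) < r) by (rewrite Rminus_diag, Rabs_R0; assumption).
  assert (C1 : Rabs (v0 - v0) < r) by (rewrite Rminus_diag, Rabs_R0; assumption).
  assert (HA : forall u v, S u v ->
     Ev u v * G u v / E u v = Ev u0 v * G u0 v / E u0 v).
  { intros u v [Su Sv].
    apply (zero_derivative_constant (fun t => Ev t v * G t v / E t v) u0 r); [|assumption].
    intros s Is. assert (Ss : S s v) by (split; assumption).
    destruct (Nz s v Ss) as [nE nG]. destruct (Hpde s v Ss) as [P1 _].
    assert (H := derivable_pt_lim_ratio (fun t => Ev t v * G t v) (fun t => E t v) s _ _ nE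
      (derivable_pt_lim_mult (fun t => Ev t v) (fun t => G t v) s _ _ (HEuv s v Ss) (HGu s v Ss))
      (HEu s v Ss)).
    match type of H with derivable_pt_lim _ _ ?l => replace 0 with l; [exact H|] end.
    transitivity (G s v / E s v *
      (Euv s v - Eu s v * Ev s v / E s v + Ev s v * Gu s v / G s v));
      [unfold Rsqr; field; auto|rewrite P1; ring]. }
  (* The u-derivative of (log (E / G))_v is the first equation divided by E minus the second divided
     by G. *)
  assert (HB : forall u v, S u v ->
     Ev u v / E u v - Gv u v / G u v = Ev u0 v / E u0 v - Gv u0 v / G u0 v).
  { intros u v [Su Sv].
    apply (zero_derivative_constant (fun t => Ev t v / E t v - Gv t v / G t v) u0 r);
      [|assumption].
    intros s Is. assert (Ss : S s v) by (split; assumption).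
    destruct (Nz s v Ss) as [nE nG]. destruct (Hpde s v Ss) as [P1 P2].
    assert (H := derivable_pt_lim_minus _ _ _ _ _
      (derivable_pt_lim_ratio (fun t => Ev t v) (fun t => E t v) s _ _ nE
         (HEuv s v Ss) (HEu s v Ss))
      (derivable_pt_lim_ratio (fun t => Gv t v) (fun t => G t v) s _ _ nG
         (HGuv s v Ss) (HGu s v Ss))).
    match type of H with derivable_pt_lim _ _ ?l => replace 0 with l; [exact H|] end.
    transitivity (/ E s v *
      (Euv s v - Eu s v * Ev s v / E s v + Ev s v * Gu s v / G s v) -
      / G s v * (Guv s v - Gu s v * Gv s v / G s v + Ev s v * Gu s v / E s v));
      [unfold Rsqr; field; auto|rewrite P1, P2; ring]. }
  (* Exponentiated form: the ratio of E / G at (u, v) to its value at (u0, v) does not depend on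
     v. *)
  assert (HR : forall u v, S u v ->
     E u v * G u0 v / (G u v * E u0 v) = E u v0 * G u0 v0 / (G u v0 * E u0 v0)).
  { intros u v [Su Sv].
    apply (zero_derivative_constant (fun t => E u t * G u0 t / (G u t * E u0 t)) v0 r);
      [|assumption].
    intros s Is. assert (Ss : S u s) by (split; assumption).
    assert (S0 : S u0 s) by (split; assumption).
    destruct (Nz u s Ss) as [nE nG]. destruct (Nz u0 s S0) as [nE0 nG0].
    pose proof (HB u s Ss) as Hb.
    assert (H := derivable_pt_lim_ratio (fun t => E u t * G u0 t) (fun t => G u t * E u0 t)
      s _ _ (Rmult_integral_contrapositive_currified _ _ nG nE0)
      (derivable_pt_lim_mult (fun t => E u t) (fun t => G u0 t) s _ _
         (HEv u s Ss) (HGv u0 s S0))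
      (derivable_pt_lim_mult (fun t => G u t) (fun t => E u0 t) s _ _
         (HGv u s Ss) (HEv u0 s S0))).
    match type of H with derivable_pt_lim _ _ ?l => replace 0 with l; [exact H|] end.
    transitivity (E u s * G u0 s / (G u s * E u0 s) *
      ((Ev u s / E u s - Gv u s / G u s) - (Ev u0 s / E u0 s - Gv u0 s / G u0 s)));
      [unfold Rsqr; field; auto|rewrite Hb; ring]. }
  pose (rho := fun u v => E u v / G u v).
  assert (Hrho : forall u v, S u v -> rho u v * rho u0 v0 = rho u v0 * rho u0 v).
  { intros u v Suv. pose proof (HR u v Suv) as H. pose proof Suv as [Su Sv].
    destruct (Nz u v Suv). destruct (Nz u v0 (conj Su C1)).
    destruct (Nz u0 v (conj C0 Sv)). destruct (Nz u0 v0 (conj C0 C1)).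
    unfold rho.
    transitivity (E u v * G u0 v / (G u v * E u0 v) * (E u0 v / G u0 v * (E u0 v0 / G u0 v0)));
      [field; auto|]. rewrite H. field; auto. }
  assert (Hrp : forall u v, S u v -> rho u v <> 0).
  { intros u v Suv. destruct (Hpos u v Suv). unfold rho.
    apply Rgt_not_eq. apply Rdiv_lt_0_compat; assumption. }
  (* Additive counterpart for lambda = E / rho(u, v0): the difference lambda(u, v) - lambda(u0, v)
     does not depend on v. Its v-derivative is rho(u0, v) / rho(u0, v0) times the difference of E_v
     G / E at u and u0, which [HA] kills. *)
  assert (HL : forall u v, S u v ->
    E u v / rho u v0 - E u0 v / rho u0 v0 = E u v0 / rho u v0 - E u0 v0 / rho u0 v0).
  { intros u v [Su Sv].
    apply (zero_derivative_constant (fun t => E u t / rho u v0 - E u0 t / rho u0 v0) v0 r);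
      [|assumption].
    intros s Is. assert (Ss : S u s) by (split; assumption).
    assert (S0 : S u0 s) by (split; assumption).
    assert (H := derivable_pt_lim_minus _ _ _ _ _
      (derivable_pt_lim_scal _ (/ rho u v0) _ _ (HEv u s Ss))
      (derivable_pt_lim_scal _ (/ rho u0 v0) _ _ (HEv u0 s S0))).
    apply is_derive_Reals. apply is_derive_Reals in H.
    match type of H with is_derive _ _ ?l => replace 0 with l end.
    - eapply is_derive_ext; [|exact H]. intros w.
      match goal with |- ?l = ?m => change (l = m :> R) end.
      unfold minus_fct, mult_real_fct. field. split; apply Hrp; split; assumption.
    - pose proof (HA u s Ss) as Ha. pose proof (Hrho u s Ss) as Hr.
      destruct (Nz u s Ss) as [nE nG]. destruct (Nz u0 s S0) as [nE0 nG0].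
      assert (n1 := Hrp u v0 (conj Su C1)). assert (n2 := Hrp u0 v0 (conj C0 C1)).
      assert (n3 := Hrp u s Ss). assert (n4 := Hrp u0 s S0).
      replace (rho u v0) with (rho u s * rho u0 v0 / rho u0 s)
        by (rewrite Hr; field; auto).
      transitivity (rho u0 s / rho u0 v0 *
        (Ev u s * G u s / E u s - Ev u0 s * G u0 s / E u0 s));
        [|rewrite Ha; ring].
      change (rho u s) with (E u s / G u s). change (rho u0 s) with (E u0 s / G u0 s).
      field. repeat split; assumption. }
  (* U2 is E / G on the line v = v0, V2 is fixed by U2 / V2 = E / G, and U1 - V1 is lambda(u, v0) +
     lambda(u0, v) - lambda(u0, v0). *)
  exists (fun u => E u v0 / rho u v0), (fun u => rho u v0),
    (fun v => E u0 v0 / rho u0 v0 - E u0 v / rho u0 v0), (fun v => rho u0 v0 / rho u0 v).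
  intros u v Suv. pose proof Suv as [Su Sv].
  assert (n1 := Hrp u v0 (conj Su C1)). assert (n2 := Hrp u0 v0 (conj C0 C1)).
  assert (n3 := Hrp u v Suv). assert (n4 := Hrp u0 v (conj C0 Sv)).
  destruct (Nz u v Suv) as [nE nG].
  replace (E u v0 / rho u v0 - (E u0 v0 / rho u0 v0 - E u0 v / rho u0 v0))
    with (E u v / rho u v0) by (pose proof (HL u v Suv); lra).
  split; [field; assumption|].
  transitivity (E u v / rho u v0 * (rho u v0 / rho u v)).
  - unfold rho at 3. field. auto.
  - f_equal. pose proof (Hrho u v Suv).
    apply Rmult_eq_reg_r with (rho u v * rho u0 v);
      [|apply Rmult_integral_contrapositive_currified; assumption].
    transitivity (rho u v0 * rho u0 v); [field; auto|].
    rewrite <- H. field; auto.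
Qed.

Theorem mainTheorem7 (D : R -> R -> Prop) (E F G : R -> R -> R)
  (HD : is_open2 D) (Hg : riemannian_metric D E F G)
  (Hivory : ivory_property D E F G) :
  forall u0 v0, D u0 v0 ->
    exists r, 0 < r /\
    exists U1 U2 V1 V2 : R -> R,
      forall u v, in_square u0 v0 r u v ->
        E u v = (U1 u - V1 v) * U2 u /\
        F u v = 0 /\
        G u v = (U1 u - V1 v) * V2 v.
Proof.
  intros u0 v0 Hm.
  assert (HF := ivory_orthogonal D E F G HD Hg Hivory).
  destruct Hg as (SE & SF & SG & Hpos).
  (* Order 3 leaves first derivatives of class C^2, as the Taylor bounds for the spray coefficients
     require. *)
  destruct (Ck2_partials 2 _ _ (SE 3%nat)) as (Eu & Ev & HEu & HEv & CEu & CEv).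
  destruct (Ck2_partials 2 _ _ (SG 3%nat)) as (Gu & Gv & HGu & HGv & CGu & CGv).
  destruct (Ck2_partials 1 _ _ CEu) as (Euu & Euv & HEuu & HEuv & _ & CEuv).
  destruct (Ck2_partials 1 _ _ CEv) as (Evu & Evv & HEvu & HEvv & CEvu & _).
  destruct (Ck2_partials 1 _ _ CGu) as (Guu & Guv & HGuu & HGuv & _ & CGuv).
  destruct (Ck2_partials 1 _ _ CGv) as (Gvu & Gvv & HGvu & HGvv & CGvu & _).
  (* The two mixed partials are separate witnesses. The equations are obtained with [Euv] and [Guv],
     but their integration uses the u-derivatives [Evu] and [Gvu] of [Ev] and [Gv]. *)
  assert (SymE : forall u v, D u v -> Evu u v = Euv u v).
  { intros u v Duv. symmetry.
    apply (Ck2_mixed_partials D E Eu Ev); auto; eapply Ck2_cont2; eassumption. }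
  assert (SymG : forall u v, D u v -> Gvu u v = Guv u v).
  { intros u v Duv. symmetry.
    apply (Ck2_mixed_partials D G Gu Gv); auto; eapply Ck2_cont2; eassumption. }
  assert (Hpde : forall u v, D u v ->
    Evu u v - Eu u v * Ev u v / E u v + Ev u v * Gu u v / G u v = 0 /\
    Gvu u v - Gu u v * Gv u v / G u v + Ev u v * Gu u v / E u v = 0).
  { intros u v Duv. rewrite SymE, SymG by assumption.
    destruct (Hivory u v Duv) as (r' & rpos' & Hr' & Hiv).
    apply (ivory_second_order D E F G Eu Ev Gu Gv Euu Euv Evu Evv Guu Guv Gvu Gvv u v r');
      auto. }
  destruct (HD u0 v0 Hm) as (r & rpos & Hr).
  destruct (liouville_of_pde u0 v0 r E G Eu Ev Gu Gv Evu Gvu rpos)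
    as (U1 & U2 & V1 & V2 & HU).
  - intros u v S. destruct (Hpos u v (Hr u v S)) as [P1 P2].
    rewrite HF in P2 by auto. split; [assumption|].
    apply Rmult_lt_reg_l with (E u v); [assumption|]. simpl in P2. lra.
  - apply (partial_u_sub D); assumption.
  - apply (partial_v_sub D); assumption.
  - apply (partial_u_sub D); assumption.
  - apply (partial_v_sub D); assumption.
  - apply (partial_u_sub D); assumption.
  - apply (partial_u_sub D); assumption.
  - intros u v S. apply Hpde, Hr, S.
  - exists r. split; [assumption|]. exists U1, U2, V1, V2. intros u v S.
    destruct (HU u v S). auto.
Qed.
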